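(* Let $X\in\mathbb{R}^{n\times p}$ be a design matrix with rows $x_1^\top,\dots,x_n^\top$, $y\in\{0,1\}^n$, $m_0\in\mathbb{R}^p$ and $Q_0\in\mathbb{R}^{p\times p}$ a prior precision matrix. Consider the two-block CAVI algorithm for Bayesian probit regression with latent-Gaussian augmentation, with updates $\mu_{k+1}^1=\mu_\star^1[\mu_k^2]$, $\mu_{k+1}^2=\mu_\star^2[\mu_{k+1}^1]$, where $$\mu_\star^1[\mu^2](dz)\propto\bigotimes_{i=1}^n\mathcal{N}(dz_i;x_i^\top\mathbb{E}_{\mu^2}[\beta],1)\left\{y_i\mathbf 1(z_i>0)+(1-y_i)\mathbf 1(z_i\le0)\right\},$$ $$\mu_\star^2[\mu^1]=\mathcal{N}(m_{\mu^1},Q^{-1}),\quad m_{\mu^1}=Q^{-1}(Q_0m_0+X^\top\mathbb{E}_{\mu^1}[Z]),\quad Q=Q_0+X^\top X.$$ Then the iterates $(\mu_k^1,\mu_k^2)_{k\ge0}$ converge globally exponentially fast in Wasserstein-$2$ distance with rate $$r=\lambda_{\max}\left((Q_0+X^\top X)^{-1}X^\top X\right).$$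
   Context: The target is the augmented posterior $\pi(dz,d\beta)\propto\mathcal{N}(d\beta;m_0,Q_0^{-1})\,\mathcal{N}(dz;X\beta,I_n)\prod_{i=1}^n\{y_i\mathbf 1(z_i>0)+(1-y_i)\mathbf 1(z_i\le0)\}$ on $\mathbb{R}^n\times\mathbb{R}^p$, arising from $Y_i\mid\beta\sim\mathrm{Ber}(\Phi(x_i^\top\beta))$ with $\Phi$ the standard Gaussian cdf and prior $\beta\sim\mathcal{N}(m_0,Q_0^{-1})$. The updates are the coordinatewise minimisers of $\mathrm{KL}(\mu^1\otimes\mu^2\|\pi)$. The convergence is to the fixed point $(\mu_\star^1,\mu_\star^2)$ of the updates, i.e. $\mu_\star^1=\mu_\star^1[\mu_\star^2]$ and $\mu_\star^2=\mu_\star^2[\mu_\star^1]$; ''globally'' means without restriction of the initialisation to a neighbourhood of the fixed point (among probability measures with finite second moment). $\lambda_{\max}$ is the largest eigenvalue. *)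

(* Defs.v *)
From HB Require Import structures.
From mathcomp Require Import all_boot all_order all_algebra.
From mathcomp Require Import all_classical all_reals all_analysis.
From mathcomp Require Import measurable_realfun.

Set Implicit Arguments.
Unset Strict Implicit.
Unset Printing Implicit Defensive.
Import Order.TTheory GRing.Theory Num.Theory.
Import numFieldNormedType.Exports.

Local Open Scope classical_set_scope.
Local Open Scope ring_scope.

(* The space R^n is [n.-tuple R] with its product sigma-algebra; [tvec] reads a
   point as a column vector for matrix algebra.  One-dimensional factors live on
   [measurableTypeR R], i.e. R with its Borel sigma-algebra, where the library
   defines the Lebesgue and normal measures. *)

Definition tvec (R : realType) (n : nat) (x : n.-tuple R) : 'cV[R]_n :=
  \col_i tnth x i.

Definition origin (R : realType) (n : nat) : n.-tuple R :=
  [tuple of nseq n 0].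

Section cons_measure.
Local Open Scope ereal_scope.
Variables (R : realType) (n : nat).
Variables (m : {sigma_finite_measure set (measurableTypeR R) -> \bar R}).
Variables (mu : {measure set (n.-tuple R) -> \bar R}).

Let glue (u : n.-tuple R * measurableTypeR R) : n.+1.-tuple R := [tuple of u.2 :: u.1].

Let measurable_glue : measurable_fun setT glue.
Proof. by apply: measurable_cons; [exact: measurable_snd|exact: measurable_fst]. Qed.

(* the tail, not the head, comes first because [\x] asks sigma-finiteness of
   its second factor only *)
Definition cons_measure : set (n.+1.-tuple R) -> \bar R :=
  pushforward (mu \x m) glue.

Let cons_measure0 : cons_measure set0 = 0.
Proof. by rewrite /cons_measure /pushforward preimage_set0 measure0. Qed.

Let cons_measure_ge0 A : 0 <= cons_measure A.
Proof. exact: measure_ge0. Qed.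

Let cons_measure_sigma_additive : semi_sigma_additive cons_measure.
Proof.
move=> F mF tF mUF; rewrite /cons_measure /pushforward preimage_bigcup.
apply: measure_semi_sigma_additive.
- by move=> k; rewrite -[X in measurable X]setTI; exact: measurable_glue.
- apply/trivIsetP => /= i j _ _ ij; rewrite -preimage_setI.
  by move/trivIsetP : tF => /(_ _ _ _ _ ij) ->//; rewrite preimage_set0.
- by rewrite -preimage_bigcup -[X in measurable X]setTI; exact: measurable_glue.
Qed.

HB.instance Definition _ := isMeasure.Build _ _ _ cons_measure
  cons_measure0 cons_measure_ge0 cons_measure_sigma_additive.

End cons_measure.

Fixpoint prod_measure (R : realType) (n : nat) :
    ('I_n -> {sigma_finite_measure set (measurableTypeR R) -> \bar R}) ->
    {measure set (n.-tuple R) -> \bar R} :=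
  match n with
  | 0 => fun _ => dirac ([tuple] : 0.-tuple R)
  | n'.+1 => fun m =>
      cons_measure (m ord0) (prod_measure (fun i => m (lift ord0 i)))
  end.

Definition lebesgue_tuple (R : realType) (n : nat) :
    {measure set (n.-tuple R) -> \bar R} :=
  prod_measure (fun _ : 'I_n => @lebesgue_measure R).

Section gaussian.
Variables (R : realType) (n : nat) (m : 'cV[R]_n) (S : 'M[R]_n).

Definition gaussian_fun (x : n.-tuple R) : R :=
  expR (- (2^-1 * ((tvec x - m)^T *m invmx S *m (tvec x - m)) ord0 ord0)).

Let measurable_gaussian_fun : measurable_fun setT gaussian_fun.
Proof.
apply: measurableT_comp => //; apply: measurableT_comp => //.
apply: measurable_funM => //.
have mc (i : 'I_n) : measurable_fun setT
    (fun x : n.-tuple R => (tvec x - m) i ord0).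
  apply: (eq_measurable_fun (fun x : n.-tuple R => tnth x i - m i ord0)).
    by move=> x _; rewrite !mxE.
  by apply: measurable_funB => //; exact: measurable_tnth.
apply: (eq_measurable_fun (fun x : n.-tuple R =>
  \sum_(j < n) (\sum_(i < n) (tvec x - m) i ord0 * invmx S i j) *
               (tvec x - m) j ord0)).
  move=> x _; rewrite mxE; apply: eq_bigr => j _; congr (_ * _).
  by rewrite mxE; apply: eq_bigr => i _; rewrite [in RHS]mxE.
apply: measurable_sum => j; apply: measurable_funM; last exact: mc.
by apply: measurable_sum => i; apply: measurable_funM; [exact: mc|].
Qed.

Definition gaussian_weight (A : set (n.-tuple R)) : \bar R :=
  (\int[@lebesgue_tuple R n]_(x in A) (gaussian_fun x)%:E)%E.

Let gaussian_weight0 : gaussian_weight set0 = 0%E.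
Proof. exact: integral_set0. Qed.

Let gaussian_weight_ge0 A : (0 <= gaussian_weight A)%E.
Proof. by apply: integral_ge0 => x _; rewrite lee_fin expR_ge0. Qed.

Let gaussian_weight_sigma_additive : semi_sigma_additive gaussian_weight.
Proof.
move=> F mF tF mUF; rewrite /gaussian_weight ge0_integral_bigcup//; last first.
- by move=> x _; rewrite lee_fin expR_ge0.
- apply: measurable_funTS; apply/measurable_EFinP.
  exact: measurable_gaussian_fun.
- apply: is_cvg_ereal_nneg_natsum_cond => k _ _.
  by apply: integral_ge0 => x _; rewrite lee_fin expR_ge0.
Qed.

HB.instance Definition _ := isMeasure.Build _ _ _ gaussian_weight
  gaussian_weight0 gaussian_weight_ge0 gaussian_weight_sigma_additive.

(* N(m, S) for a symmetric positive definite covariance S: the probability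
   whose Lebesgue density is proportional to [gaussian_fun].  The last argument
   of [mnormalize] is a default, unused when the total mass is in ]0, +oo[. *)
Definition gaussian : probability (n.-tuple R) R :=
  mnormalize gaussian_weight (dirac (origin R n)).

End gaussian.

Section wasserstein.
Variables (R : realType) (n : nat).
Implicit Types mu nu : probability (n.-tuple R) R.

Definition sqdist (x y : n.-tuple R) : R :=
  \sum_(i < n) (tnth x i - tnth y i) ^+ 2.

Definition coupling mu nu (g : probability (n.-tuple R * n.-tuple R)%type R) :=
  forall A : set (n.-tuple R), measurable A ->
    g (A `*` setT) = mu A /\ g (setT `*` A) = nu A.

Definition wasserstein2 mu nu : \bar R :=
  poweR (ereal_inf
    [set \int[g]_u (sqdist u.1 u.2)%:E | g in coupling mu nu])%E 2^-1.

Definition finite_second_moment mu : Prop :=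
  (\int[mu]_x (\sum_(i < n) tnth x i ^+ 2)%:E < +oo)%E.

Definition mean mu : 'cV[R]_n := \col_i \int[mu]_x tnth x i.

End wasserstein.

Definition posdefmx (R : realType) (p : nat) (A : 'M[R]_p) : Prop :=
  A^T = A /\
  forall v : 'cV[R]_p, v != 0 -> 0 < (v^T *m A *m v) ord0 ord0.

(* Supremum of the real eigenvalues.  It is their maximum as soon as there is
   one, which is the case for a product of a positive definite and a positive
   semidefinite matrix of positive size, whose spectrum is real. *)
Definition lambda_max (R : realType) (p : nat) (A : 'M[R]_p) : R :=
  sup [set a : R | eigenvalue A a].

(* {z | y 1(z > 0) + (1 - y) 1(z <= 0) = 1} *)
Definition half_line (R : realType) (y : bool) : set (measurableTypeR R) :=
  if y then [set` `]0, +oo[] else [set` `]-oo, 0]].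

Lemma measurable_half_line (R : realType) (y : bool) :
  measurable (@half_line R y).
Proof. by rewrite /half_line; case: y; exact: measurable_itv. Qed.

Section probit_cavi.
Variables (R : realType) (n p : nat) (X : 'M[R]_(n, p)) (y : n.-tuple bool).
Variables (m0 : 'cV[R]_p) (Q0 : 'M[R]_p).

Definition post_prec : 'M[R]_p := Q0 + X^T *m X.

(* the unnormalised factor N(dz_i; eta, 1) {y_i 1(z_i > 0) + (1 - y_i) 1(z_i <= 0)} *)
Definition truncated_factor (eta : R) (b : bool) :
    {finite_measure set (measurableTypeR R) -> \bar R} :=
  mrestr (normal_prob eta 1) (@measurable_half_line R b).

Definition update1 (mu2 : probability (p.-tuple R) R) :
    probability (n.-tuple R) R :=
  mnormalize
    (prod_measure (fun i => truncated_factor ((X *m mean mu2) i ord0) (tnth y i)))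
    (dirac (origin R n)).

Definition update2 (mu1 : probability (n.-tuple R) R) :
    probability (p.-tuple R) R :=
  gaussian (invmx post_prec *m (Q0 *m m0 + X^T *m mean mu1)) (invmx post_prec).

Definition cavi_step (mu : probability (n.-tuple R) R * probability (p.-tuple R) R) :=
  let nu1 := update1 mu.2 in (nu1, update2 nu1).

Definition cavi mu k := iter k cavi_step mu.

Definition cavi_fixed_point
    (mu : probability (n.-tuple R) R * probability (p.-tuple R) R) : Prop :=
  mu.1 = update1 mu.2 /\ mu.2 = update2 mu.1.

End probit_cavi.

(* Main.v *)
Require Import Defs.
From HB Require Import structures.
From mathcomp Require Import all_boot all_order all_algebra.
From mathcomp Require Import all_classical all_reals all_analysis.
From mathcomp Require Import measurable_realfun ring lra.

Set Implicit Arguments.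
Unset Strict Implicit.
Unset Printing Implicit Defensive.
Import Order.TTheory GRing.Theory Num.Theory.
Import numFieldNormedType.Exports.

Local Open Scope classical_set_scope.
Local Open Scope ring_scope.

(** The updates depend on their input only through its mean.  Write Q for
    Q0 + X^T X, v for the mean of the beta-block, and f for the map sending the
    vector X v of location parameters to the mean of the product of truncated
    normals.  Coupling the factors through their quantile functions displaces
    every coordinate by at most the displacement of its location parameter:
    the truncated normals have a monotone likelihood ratio in the location
    parameter, and so do a translated truncated normal and the truncation of
    the translated normal.  Hence the W2 distance of the z-blocks is at most
    |X (v - v')|, and f is 1-Lipschitz because W2 dominates the distance of the
    means.  The beta-blocks are translates of each other, so their W2 distance
    is the distance of their means.  With w = Q^-1 X^T (f (X v) - f (X v')),
    Cauchy-Schwarz gives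
      w^T Q w = (X w)^T (f (X v) - f (X v')) <= |X w| |X (v - v')|,
    and |X u|^2 <= r u^T Q u by the variational description of r, so the means
    are contracted by r in the norm of Q. *)

(** * Quadratic forms and the rate *)

Definition bform (R : realType) (p : nat) (M : 'M[R]_p) (u v : 'cV[R]_p) : R :=
  (u^T *m M *m v) ord0 ord0.

Notation qform M v := (bform M v v).

Definition sqnorm (R : realType) (p : nat) (v : 'cV[R]_p) : R :=
  \sum_i v i ord0 ^+ 2.

Lemma sqnorm_ge0 (R : realType) (p : nat) (v : 'cV[R]_p) : 0 <= sqnorm v.
Proof. by apply: sumr_ge0 => i _; exact: sqr_ge0. Qed.

Lemma bformDl (R : realType) (p : nat) (M : 'M[R]_p) u v w :
  bform M (u + v) w = bform M u w + bform M v w.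
Proof. by rewrite /bform linearD /= !mulmxDl mxE. Qed.

Lemma bformDr (R : realType) (p : nat) (M : 'M[R]_p) u v w :
  bform M w (u + v) = bform M w u + bform M w v.
Proof. by rewrite /bform mulmxDr mxE. Qed.

Lemma bformZl (R : realType) (p : nat) (M : 'M[R]_p) a u w :
  bform M (a *: u) w = a * bform M u w.
Proof. by rewrite /bform linearZ /= -!scalemxAl mxE. Qed.

Lemma bformZr (R : realType) (p : nat) (M : 'M[R]_p) a u w :
  bform M w (a *: u) = a * bform M w u.
Proof. by rewrite /bform -scalemxAr mxE. Qed.

Lemma bform_sym (R : realType) (p : nat) (M : 'M[R]_p) u v : M^T = M ->
  bform M u v = bform M v u.
Proof.
move=> Ms; rewrite /bform.
have -> : u^T *m M *m v = (v^T *m M *m u)^T by rewrite !trmx_mul Ms trmxK mulmxA.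
by rewrite mxE.
Qed.

Lemma bform_mxD (R : realType) (p : nat) (M N : 'M[R]_p) u v :
  bform (M + N) u v = bform M u v + bform N u v.
Proof. by rewrite /bform mulmxDr mulmxDl mxE. Qed.

Lemma bform_mxZ (R : realType) (p : nat) a (M : 'M[R]_p) u v :
  bform (a *: M) u v = a * bform M u v.
Proof. by rewrite /bform -scalemxAr -scalemxAl mxE. Qed.

Lemma qform_gram (R : realType) (n p : nat) (X : 'M[R]_(n, p)) v :
  qform (X^T *m X) v = sqnorm (X *m v).
Proof.
rewrite /bform mulmxA -trmx_mul -mulmxA mxE; apply: eq_bigr => i _.
by rewrite mxE expr2.
Qed.

(** The polynomial t -> [qform M (u + t *: v)] is nonnegative; evaluation at its minimiser gives the
    claim. Semidefiniteness allows a vanishing leading coefficient c, which is treated apart. *)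
Lemma bform_CauchySchwarz (R : realType) (p : nat) (M : 'M[R]_p) u v :
  M^T = M -> (forall w, 0 <= qform M w) ->
  bform M u v ^+ 2 <= qform M u * qform M v.
Proof.
move=> Ms M0; set a := qform M u; set b := bform M u v; set c := qform M v.
have E t : 0 <= a + 2 * t * b + t ^+ 2 * c.
  have := M0 (u + t *: v).
  rewrite bformDl !bformDr !bformZl !bformZr (bform_sym v u Ms) -/a -/b -/c.
  by move=> h; apply: le_trans h _; rewrite le_eqVlt; apply/orP; left; apply/eqP; ring.
have c0 : 0 <= c by exact: M0.
have [cE|cN] := eqVneq c 0.
  have [->|bN] := eqVneq b 0; first by rewrite expr0n /= mulr_ge0// M0.
  (* With c = 0 the polynomial is affine with slope 2 b; at this t it would take the value -1. *)
  have := E (- (a + 1) / (2 * b)); rewrite cE.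
  have -> : a + 2 * (- (a + 1) / (2 * b)) * b + (- (a + 1) / (2 * b)) ^+ 2 * 0 = - 1.
    by field.
  by rewrite oppr_ge0 ler10.
have cp : 0 < c by rewrite lt_def cN.
have := E (- b / c).
have -> : a + 2 * (- b / c) * b + (- b / c) ^+ 2 * c = a - b ^+ 2 / c by field.
by rewrite subr_ge0 ler_pdivrMr.
Qed.

(** The bound |v_i v_j| <= |v|^2 makes the sum of the absolute values of the entries a sufficient
    constant. *)
Lemma qform_le_sqnorm (R : realType) (p : nat) (M : 'M[R]_p) :
  exists2 L : R, 0 <= L & forall v, qform M v <= L * sqnorm v.
Proof.
exists (\sum_i \sum_j `|M i j|); first by do 2 (apply: sumr_ge0 => ? _).
move=> v; have -> : qform M v = \sum_j \sum_i v i ord0 * M i j * v j ord0.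
  rewrite /bform mxE; apply: eq_bigr => j _; rewrite mxE big_distrl /=.
  by apply: eq_bigr => i _; rewrite mxE.
rewrite exchange_big big_distrl /=; apply: ler_sum => i _.
rewrite big_distrl /=; apply: ler_sum => j _.
have le k : v k ord0 ^+ 2 <= sqnorm v.
  by rewrite /sqnorm (bigD1 k) //= lerDl sumr_ge0 // => l _; exact: sqr_ge0.
apply: le_trans (ler_norm _) _.
have -> : `|v i ord0 * M i j * v j ord0| = `|M i j| * (`|v i ord0| * `|v j ord0|).
  by rewrite !normrM; ring.
rewrite ler_wpM2l //; have := le i; have := le j.
rewrite -(real_normK (num_real (v i ord0))) -(real_normK (num_real (v j ord0))).
have := sqr_ge0 (`|v i ord0| - `|v j ord0|); nra.
Qed.

(** The coordinate v_i is the [M]-product of v with M^-1 e_i, so Cauchy-Schwarz for [M] bounds its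
    square. The resulting constant is the trace of M^-1. *)
Lemma sqnorm_le_qform (R : realType) (p : nat) (M : 'M[R]_p) :
  M^T = M -> (forall w, 0 <= qform M w) -> M \in unitmx ->
  exists2 K : R, 0 <= K & forall v, sqnorm v <= K * qform M v.
Proof.
move=> Ms M0 Mu; pose w i : 'cV[R]_p := invmx M *m delta_mx i ord0.
exists (\sum_i qform M (w i)); first by apply: sumr_ge0 => i _; exact: M0.
move=> v; rewrite big_distrl /=; apply: ler_sum => i _.
suff -> : v i ord0 = bform M (w i) v by exact: bform_CauchySchwarz.
rewrite /bform /w trmx_mul trmx_inv Ms -(mulmxA _ (invmx M)) mulVmx // mulmx1.
by rewrite trmx_delta -rowE mxE.
Qed.

(** Both forms are compared with the Euclidean norm. In [lambda_maxP] this quantitative positivity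
    yields r < 1 and the singularity of s Q - A. *)
Lemma qform_dominates (R : realType) (p : nat) (M N : 'M[R]_p) :
  M^T = M -> (forall w, 0 <= qform M w) -> M \in unitmx ->
  exists2 c : R, 0 < c & forall v, c * qform N v <= qform M v.
Proof.
move=> Ms M0 Mu; have [K K0 hK] := sqnorm_le_qform Ms M0 Mu.
have [L L0 hL] := qform_le_sqnorm N.
have pos : 0 < L * K + 1 by rewrite ltr_wpDl // mulr_ge0.
exists (L * K + 1)^-1; first by rewrite invr_gt0.
move=> v; rewrite mulrC ler_pdivrMr //; apply: le_trans (hL v) _.
apply: le_trans (ler_wpM2l L0 (hK v)) _.
by have := M0 v; nra.
Qed.

Lemma posdefmx_ge0 (R : realType) (p : nat) (M : 'M[R]_p) :
  posdefmx M -> forall v, 0 <= qform M v.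
Proof.
move=> [_ Mp] v; have [->|/Mp/ltW//] := eqVneq v 0.
by rewrite /bform mulmx0 mxE.
Qed.

Lemma posdefmx_unit (R : realType) (p : nat) (M : 'M[R]_p) :
  posdefmx M -> M \in unitmx.
Proof.
move=> [Ms Mp]; rewrite unitmxE unitfE; apply/det0P => -[w w0 wM].
have := Mp w^T; rewrite trmx_eq0 trmxK wM mul0mx mxE ltxx => /(_ w0); by [].
Qed.

Lemma posdefmxD_gram (R : realType) (n p : nat) (X : 'M[R]_(n, p)) (Q0 : 'M[R]_p) :
  posdefmx Q0 -> posdefmx (Q0 + X^T *m X).
Proof.
move=> [Qs Qp]; split; first by rewrite linearD /= trmx_mul trmxK Qs.
move=> v v0; rewrite -/(bform _ v v) bform_mxD qform_gram.
by rewrite ltr_pwDl ?Qp// sqnorm_ge0.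
Qed.

(** The substitution u = w Q turns the eigenvalue equation of Q^-1 A into one between A and Q
    themselves, which can be tested with quadratic forms. Eigenvectors are row vectors. *)
Lemma eigenvalue_invmx_mulmxP (R : realType) (p : nat) (A Q : 'M[R]_p) a :
  Q \in unitmx ->
  eigenvalue (invmx Q *m A) a <->
  exists2 w : 'rV[R]_p, w != 0 & w *m A = a *: (w *m Q).
Proof.
move=> Qu; split => [/eigenvalueP[u uE u0]|[w w0 wE]].
  exists (u *m invmx Q); last by rewrite -mulmxA uE mulmxKV.
  by apply: contra_neq u0 => /(congr1 (mulmx^~ Q)); rewrite mulmxKV// mul0mx.
apply/eigenvalueP; exists (w *m Q); first by rewrite mulmxA mulmxK.
by apply: contra_neq w0 => /(congr1 (mulmx^~ (invmx Q))); rewrite mulmxK// mul0mx.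
Qed.

(* With s the least real such that s Q - A is positive semidefinite, s Q - A
   must be singular, and hence s is an eigenvalue of Q^-1 A. *)
Lemma lambda_maxP (R : realType) (n p : nat) (X : 'M[R]_(n, p)) (Q0 : 'M[R]_p) :
  (0 < p)%N -> posdefmx Q0 ->
  let r := lambda_max (invmx (Q0 + X^T *m X) *m (X^T *m X)) in
  0 <= r < 1 /\
  forall v, sqnorm (X *m v) <= r * qform (Q0 + X^T *m X) v.
Proof.
move=> p_gt0 Q0p; set A := X^T *m X; set Q := Q0 + A.
have Qp : posdefmx Q by exact: posdefmxD_gram.
have [[Q0s _] [Qs Qpos]] := (Q0p, Qp).
have Q_ge0 := posdefmx_ge0 Qp.
have As : A^T = A by rewrite /A trmx_mul trmxK.
pose E := [set t : R | forall v, qform A v <= t * qform Q v].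
(* Since A = Q - Q0, the bound c Q <= Q0 says that 1 - c lies in [E]; this is the source of r <
   1. *)
have [c c0 hc] := qform_dominates Q Q0s (posdefmx_ge0 Q0p) (posdefmx_unit Q0p).
have Ec : E (1 - c).
  move=> v; have := hc v; rewrite {2}/Q mulrBl mul1r bform_mxD; lra.
(* Evaluation at one nonzero vector bounds [E] below by 0; p > 0 provides the vector. *)
have E_ge0 t : E t -> 0 <= t.
  pose v : 'cV[R]_p := const_mx 1.
  have v0 : v != 0.
    apply/eqP => /matrixP/(_ (Ordinal p_gt0) ord0); rewrite !mxE.
    by move/eqP; rewrite oner_eq0.
  move=> /(_ v); rewrite qform_gram => h.
  have := le_trans (sqnorm_ge0 _) h; rewrite pmulr_lge0//; exact: Qpos.
have Einf : has_inf E by split; [exists (1 - c)|exists 0 => t /E_ge0].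
pose s := inf E.
have s_ge0 : 0 <= s by apply: lb_le_inf; [exists (1 - c)|move=> t /E_ge0].
(* For fixed v <> 0 membership in [E] reads [qform A v / qform Q v <= t], which passes to the
   infimum. *)
have Es : E s.
  move=> v; have [->|v0] := eqVneq v 0; first by rewrite /bform !mulmx0 !mxE mulr0.
  have Qv : 0 < qform Q v by exact: Qpos.
  rewrite -ler_pdivrMr //; apply: lb_le_inf; first by exists (1 - c).
  by move=> t Et; rewrite ler_pdivrMr.
have s_lt1 : s < 1.
  by apply: le_lt_trans (ge_inf Einf.2 Ec) _; rewrite gtrBl.
have Qu : Q \in unitmx by exact: posdefmx_unit.
have eig_s : eigenvalue (invmx Q *m A) s.
  apply/(eigenvalue_invmx_mulmxP _ _ Qu).
  pose M := s *: Q + (-1) *: A.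
  have ME v : qform M v = s * qform Q v - qform A v.
    by rewrite bform_mxD !bform_mxZ mulN1r.
  have [Mu|] := boolP (M \in unitmx).
    have Ms : M^T = M by rewrite /M linearD !linearZ /= Qs As.
    have M0 v : 0 <= qform M v by rewrite ME subr_ge0; exact: Es.
    have [d d0 hd] := qform_dominates Q Ms M0 Mu.
    have : E (s - d) by move=> v; have := hd v; rewrite ME mulrBl; lra.
    by move=> /(ge_inf Einf.2); rewrite -/s lerBrDl gerDr leNgt d0.
  rewrite unitmxE unitfE negbK => /det0P[w w0 wM]; exists w => //.
  move: wM; rewrite /M mulmxDr -!scalemxAr scaleN1r => /eqP.
  by rewrite subr_eq0 => /eqP ->.
have eig_le a : eigenvalue (invmx Q *m A) a -> a <= s.
  move=> /(eigenvalue_invmx_mulmxP _ _ Qu)[w w0 wE].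
  have := Es w^T; rewrite {1}/bform trmxK wE -scalemxAl mxE.
  rewrite -[X in a * X]/((w *m Q *m w^T) ord0 ord0) -{1}[w in w *m Q]trmxK.
  by rewrite ler_pM2r//; apply: Qpos; rewrite trmx_eq0.
rewrite /=; have -> : lambda_max (invmx Q *m A) = s.
  apply/eqP; rewrite eq_le; apply/andP; split.
    by apply: ge_sup; [exists s|exact: eig_le].
  by apply: ub_le_sup; [exists s => a; exact: eig_le|].
split; first by rewrite s_ge0.
by move=> v; rewrite -qform_gram; exact: Es.
Qed.

(** * Product measures on tuples *)

(** The gluing map of [cons_measure], named so that its measurability and its interplay with
    [tuple_map] can be stated. *)
Definition tuple_cons (R : realType) (n : nat)
  (u : n.-tuple R * measurableTypeR R) : n.+1.-tuple R := [tuple of u.2 :: u.1].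

Lemma measurable_tuple_cons (R : realType) (n : nat) :
  measurable_fun setT (@tuple_cons R n).
Proof. by apply: measurable_cons; [exact: measurable_snd|exact: measurable_fst]. Qed.

Definition tuple_map (R : realType) (n : nat) (h : 'I_n -> R -> R)
  (x : n.-tuple R) : n.-tuple R := [tuple h i (tnth x i) | i < n].

Lemma measurable_tuple_map (R : realType) (n : nat) (h : 'I_n -> R -> R) :
  (forall i, measurable_fun setT (h i)) -> measurable_fun setT (tuple_map h).
Proof.
move=> mh; apply/measurable_fun_tnthP => i.
have -> : (@tnth n R)^~ i \o tuple_map h = h i \o (@tnth n R)^~ i.
  by apply/funext => x /=; rewrite tnth_mktuple.
by apply: measurableT_comp => //; exact: measurable_tnth.
Qed.

Lemma tuple_map_cons (R : realType) (n : nat) (h : 'I_n.+1 -> R -> R) u :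
  tuple_map h (tuple_cons u) =
  tuple_cons (tuple_map (fun i => h (lift ord0 i)) u.1, h ord0 u.2).
Proof.
apply: eq_from_tnth => i; rewrite tnth_mktuple.
case: (unliftP ord0 i) => [j ->|->]; rewrite ?tnth0 //.
by rewrite !tnthS tnth_mktuple.
Qed.

Lemma measurable_preimageT d1 d2 (T1 : measurableType d1) (T2 : measurableType d2)
    (f : T1 -> T2) (A : set T2) :
  measurable_fun setT f -> measurable A -> measurable (f @^-1` A).
Proof. by move=> mf mA; rewrite -[X in measurable X]setTI; exact: mf. Qed.

(** The image relation is required on measurable sets only, so that it covers measures which agree
    with a pushforward without being defined as one. *)
Lemma ge0_integral_image (R : realType) d1 d2 (T1 : measurableType d1)
    (T2 : measurableType d2) (mu : {measure set T1 -> \bar R})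
    (nu : {measure set T2 -> \bar R}) (f : T1 -> T2) (D : set T2) (g : T2 -> \bar R) :
  measurable_fun setT f ->
  (forall A, measurable A -> nu A = mu (f @^-1` A)) ->
  measurable D -> measurable_fun D g -> (forall x, 0 <= g x)%E ->
  (\int[nu]_(x in D) g x = \int[mu]_(x in f @^-1` D) g (f x))%E.
Proof.
move=> mf nuE mD mg g0.
have := @ge0_integral_pushforward _ _ _ _ _ _ mf mu D g mD mg.
move=> <- //; have mf' := mf; apply: eq_measure_integral => // A mA _; exact: nuE.
Qed.

(** Induction on n: the section at a tail x of the preimage of [A] is the preimage under [h ord0] of
    the section of [A] at the mapped tail, so head and tail are transported separately. *)
Lemma prod_measure_map (R : realType) (n : nat) (h : 'I_n -> R -> R)
    (m m' : 'I_n -> {sigma_finite_measure set (measurableTypeR R) -> \bar R}) :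
  (forall i, measurable_fun setT (h i)) ->
  (forall i A, measurable A -> m' i A = m i (h i @^-1` A)) ->
  forall A, measurable A -> prod_measure m' A = prod_measure m (tuple_map h @^-1` A).
Proof.
elim: n => [|n IH] in h m m' * => mh mE A mA.
  rewrite /= /dirac; congr (_%:E); rewrite !indicE; congr ((_ : bool)%:R).
  apply/idP/idP; rewrite !inE /=; suff -> : tuple_map h [tuple] = [tuple] by [].
    by apply: eq_from_tnth => -[].
  by apply: eq_from_tnth => -[].
pose h' i := h (lift ord0 i); pose m1 i := m (lift ord0 i).
pose m1' i := m' (lift ord0 i).
have mh' : forall i, measurable_fun setT (h' i) by move=> i; exact: mh.
have {}IH := IH h' m1 m1' mh' (fun i => mE (lift ord0 i)).
have mB : measurable (@tuple_cons R n @^-1` A).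
  exact: (measurable_preimageT (@measurable_tuple_cons R n)).
rewrite /= /cons_measure /pushforward /product_measure1.
rewrite -/(@tuple_cons R n) -/m1 -/m1'.
rewrite (ge0_integral_image (measurable_tuple_map mh') IH) //; last first.
  exact: measurable_fun_xsection.
rewrite preimage_setT.
apply: eq_integral => x _ /=.
rewrite mE; last exact: measurable_xsection.
congr (m ord0 _); apply/seteqP; split=> y /=; rewrite /xsection /= !inE /=;
 by rewrite -[X in A (tuple_map h X)]/(tuple_cons (x, y)) tuple_map_cons.
Qed.

(** One constant leaves the inner integral, the others leave the measure of the tail by induction.
    This relates the unnormalised truncated factors to the normalised ones. *)
Lemma prod_measure_scale (R : realType) (n : nat) (c : 'I_n -> {nonneg R})
    (m m' : 'I_n -> {sigma_finite_measure set (measurableTypeR R) -> \bar R}) :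
  (forall i A, measurable A -> m' i A = (c i)%:num%:E * m i A)%E ->
  forall A, measurable A ->
  prod_measure m' A = ((\prod_i (c i)%:num)%:E * prod_measure m A)%E.
Proof.
elim: n => [|n IH] in c m m' * => mE A mA; first by rewrite big_ord0 mul1e.
pose m1 i := m (lift ord0 i); pose m1' i := m' (lift ord0 i).
have {}IH := IH _ m1 m1' (fun i => mE (lift ord0 i)).
have mB : measurable (@tuple_cons R n @^-1` A).
  exact: (measurable_preimageT (@measurable_tuple_cons R n)).
rewrite /= /cons_measure /pushforward /product_measure1.
rewrite -/(@tuple_cons R n) -/m1 -/m1' big_ord_recl.
set k := \prod_(i < n) _.
have k0 : 0 <= k by apply: prodr_ge0.
transitivity (\int[mscale (NngNum k0) (prod_measure m1)]_x
    (m' ord0 \o xsection (@tuple_cons R n @^-1` A)) x)%E.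
  by apply: eq_measure_integral => B mB' _; exact: IH.
rewrite ge0_integral_mscale //=; last exact: measurable_fun_xsection.
rewrite (eq_integral (fun x => (c ord0)%:num%:E *
    m ord0 (xsection (@tuple_cons R n @^-1` A) x))%E); last first.
  by move=> x _ /=; rewrite mE //; exact: measurable_xsection.
rewrite ge0_integralZl //=; last exact: measurable_fun_xsection.
by rewrite muleA -EFinM mulrC.
Qed.

Section sigma_finite_pack.
Context (R : realType) d (T : measurableType d).
Variables (mu : {measure set T -> \bar R}) (muF : sigma_finite setT mu).

(** [prod_measure] yields a bare measure, whereas Tonelli asks for a sigma-finite structure. The
    proof is an argument of the wrapper so that the instance can recover it. *)
Definition sigma_finite_pack of sigma_finite setT mu : set T -> \bar R := mu.

HB.instance Definition _ := Measure.on (sigma_finite_pack muF).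

HB.instance Definition _ :=
  Measure_isSigmaFinite.Build d T R (sigma_finite_pack muF) muF.

End sigma_finite_pack.

(** Rectangles built from exhaustions of the tail and of the head are pulled back along the
    splitting of a tuple, the inverse of [tuple_cons]. The exhaustions are increasing, so the larger
    of two indices serves for both. *)
Lemma sigma_finite_prod_measure (R : realType) (n : nat)
    (m : 'I_n -> {sigma_finite_measure set (measurableTypeR R) -> \bar R}) :
  sigma_finite setT (prod_measure m).
Proof.
elim: n => [|n IH] in m *.
  apply: fin_num_fun_sigma_finite; first by rewrite measure0.
  by move=> A mA; exact: (@fin_num_measure _ _ _ (dirac _)).
pose m1 i := m (lift ord0 i).
have /sigma_finiteP[F [FT Fnd Ffin]] := IH m1.
have /sigma_finiteP[G [GT Gnd Gfin]] := sigma_finiteT (m ord0).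
pose split (t : n.+1.-tuple R) : n.-tuple R * measurableTypeR R := ([tuple of behead t], thead t).
have msplit : measurable_fun setT split.
  apply/measurable_fun_pairP; split.
    apply/measurable_fun_tnthP => i.
    have -> : (@tnth n R)^~ i \o (fst \o split) = (@tnth n.+1 R)^~ (lift ord0 i).
      apply/funext => t /=; rewrite (tuple_eta t) tnthS; congr tnth.
      exact/val_inj.
    exact: measurable_tnth.
  exact: measurable_tnth.
exists (fun k => split @^-1` (F k `*` G k)).
  apply/esym; rewrite -subTset => t _.
  have [k _ Fk] : (\bigcup_k F k) (split t).1 by rewrite -FT.
  have [l _ Gl] : (\bigcup_k G k) (split t).2 by rewrite -GT.
  exists (maxn k l) => //; split.
    by move: Fk; exact/subsetPset/Fnd/leq_maxl.
  by move: Gl; exact/subsetPset/Gnd/leq_maxr.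
move=> k; have [mF Foo] := Ffin k; have [mG Goo] := Gfin k; split.
  by apply: measurable_preimageT => //; exact: measurableX.
rewrite /= /cons_measure /pushforward.
have -> : (fun u : n.-tuple R * measurableTypeR R => [tuple of u.2 :: u.1])
    @^-1` (split @^-1` (F k `*` G k)) = F k `*` G k.
  have splitK u : split (tuple_cons u) = u.
    by case: u => x y; congr (_, _); exact/val_inj.
  by rewrite -comp_preimage (_ : split \o _ = id)//; apply/funext.
by rewrite product_measure1E// lte_mul_pinfty// ge0_fin_numE.
Qed.

Local Open Scope ereal_scope.

Lemma integral_prod_measureS (R : realType) (n : nat)
    (m : 'I_n.+1 -> {sigma_finite_measure set (measurableTypeR R) -> \bar R})
    (f : n.+1.-tuple R -> \bar R) :
  measurable_fun setT f -> (forall x, 0 <= f x) ->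
  \int[prod_measure m]_x f x =
  \int[prod_measure (fun i => m (lift ord0 i))]_x
    \int[m ord0]_y f (tuple_cons (x, y)).
Proof.
move=> mf f0; pose m1 i := m (lift ord0 i).
pose S : {sigma_finite_measure set (n.-tuple R) -> \bar R} :=
  sigma_finite_pack (sigma_finite_prod_measure m1).
pose P : {measure set (n.-tuple R * measurableTypeR R)%type -> \bar R} :=
  (S \x m ord0)%E.
rewrite (@ge0_integral_image _ _ _ _ _ P _ _ _ _ (@measurable_tuple_cons R n)) //.
rewrite preimage_setT (@fubini_tonelli1 _ _ _ _ _ S (m ord0)) //.
by apply: measurableT_comp => //; exact: measurable_tuple_cons.
Qed.

(** Tonelli, factor by factor. Total masses, second moments and Gaussian bounds are reduced to one
    dimension through it. *)
Lemma integral_prod_measure_prod (R : realType) (n : nat)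
    (m : 'I_n -> {sigma_finite_measure set (measurableTypeR R) -> \bar R})
    (g : 'I_n -> R -> R) :
  (forall i, measurable_fun setT (g i)) -> (forall i x, (0 <= g i x)%R) ->
  \int[prod_measure m]_x (\prod_i g i (tnth x i))%:E =
  \big[*%E/1]_i \int[m i]_x (g i x)%:E.
Proof.
elim: n => [|n IH] in m g * => mg g0.
  rewrite big_ord0 (eq_integral (fun=> 1)); last by move=> x _; rewrite big_ord0.
  by rewrite integral_cst //= mul1e diracT.
have mprod k (h : 'I_k -> R -> R) : (forall i, measurable_fun setT (h i)) ->
    measurable_fun setT (fun x : k.-tuple R => (\prod_i h i (tnth x i))%R).
  move=> mh; apply: measurable_prod => i _.
  by apply: measurableT_comp => //; exact: measurable_tnth.
rewrite integral_prod_measureS; first last.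
- by move=> x; rewrite lee_fin prodr_ge0.
- by apply/measurable_EFinP; exact: mprod.
rewrite big_ord_recl -IH; [|by move=> i; exact: mg|by move=> i; exact: g0].
rewrite -ge0_integralZl //; first last.
- by apply: integral_ge0 => x _; rewrite lee_fin.
- by move=> x _; rewrite lee_fin prodr_ge0.
- by apply/measurable_EFinP; exact: (mprod _ (fun i => g (lift ord0 i)) (fun i => mg _)).
apply: eq_integral => x _; rewrite muleC -ge0_integralZl //; first last.
- by rewrite lee_fin prodr_ge0.
- by move=> y _; rewrite lee_fin.
- by apply/measurable_EFinP; exact: mg.
apply: eq_integral => y _; rewrite -EFinM big_ord_recl mulrC tnth0.
by congr (_ * _)%:E; apply: eq_bigr => i _; rewrite tnthS.
Qed.

(** * Quantile coupling on the line *)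

(** The translated measure gives half-open intervals their length, which characterises Lebesgue
    measure. *)
Lemma lebesgue_measure_translate (R : realType) (c : R) (A : set (measurableTypeR R)) :
  measurable A -> lebesgue_measure A = lebesgue_measure ((fun x => x + c)%R @^-1` A).
Proof.
move=> mA; have mf : measurable_fun [set: measurableTypeR R]
  (fun x => (x + c)%R : measurableTypeR R).
  by apply: measurable_funD => //; exact: measurable_id.
have /= := @lebesgue_measure_unique R
  (measure_function_pushforward__canonical__measure_function_Measure
     lebesgue_measure mf).
apply => //= _ [[a b]] _ <-.
rewrite /pushforward (_ : _ @^-1` _ = `](a - c)%R, (b - c)%R]%classic); last first.
  by apply/seteqP; split=> x /=; rewrite !in_itv /= ltrBlDr lerBrDr.
rewrite !lebesgue_measure_itv /= !lte_fin ltrD2r; case: ifP => // _.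
by rewrite -!EFinB; congr (_%:E); ring.
Qed.

(** Open right rays are stable under intersection and generate the Borel sets, and the rays from -n
    exhaust the line. *)
Lemma probability_rayP (R : realType) (P P' : probability (measurableTypeR R) R) :
  (forall x : R, P `]x, +oo[%classic = P' `]x, +oo[%classic) ->
  forall A, measurable A -> P A = P' A.
Proof.
move=> E D mD; apply: (@measure_unique _ R (measurableTypeR R)
  (@RGenOInfty.G R) (fun n => `](- n%:R)%R, +oo[%classic)) => //.
- exact: RGenOInfty.measurableE.
- move=> A B [x ->] [y ->]; exists (Num.max x y); apply/seteqP; split=> z /=;
  by rewrite !in_itv /= !andbT gt_max => /andP.
- by move=> n; exists (- n%:R)%R.
- apply/seteqP; split=> // z _; exists (Num.bound `|z|) => //=.
  rewrite in_itv /= andbT ltrNl (le_lt_trans (ler_norm _))// normrN.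
  exact: archi_boundP.
- by move=> A [x ->]; exact: E.
- by move=> n; rewrite (le_lt_trans (probability_le1 _ _))// ltry.
Qed.

Definition dist_fun (R : realType) (P : probability (measurableTypeR R) R) (x : R) : R :=
  fine (P `]-oo, x]%classic).

(* The value 0 outside ]0, 1[ is arbitrary. *)
Definition quantile (R : realType) (P : probability (measurableTypeR R) R) (u : R) : R :=
  if (0 < u < 1)%R then inf [set x | (u <= dist_fun P x)%R] else 0%R.

Section quantile.
Variables (R : realType) (P : probability (measurableTypeR R) R).

Let idR : measurableTypeR R -> R := idfun.

Let midR : measurable_fun setT idR. Proof. exact: measurable_id. Qed.

HB.instance Definition _ := @isMeasurableFun.Build _ _ _ _ idR midR.

Let X : {RV P >-> R} := idR.

Let dist_fun_cdf x : (dist_fun P x)%:E = cdf X x.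
Proof. by rewrite fineK ?fin_num_measure. Qed.

Lemma dist_fun_nondecreasing : nondecreasing_fun (dist_fun P).
Proof. by move=> x y xy; rewrite -lee_fin !dist_fun_cdf; exact: cdf_nondecreasing. Qed.

Lemma dist_fun_ge0 x : (0 <= dist_fun P x)%R.
Proof. exact: fine_ge0. Qed.

Lemma dist_fun_le1 x : (dist_fun P x <= 1)%R.
Proof. by rewrite -lee_fin dist_fun_cdf; exact: cdf_le1. Qed.

(** The Galois connection between quantile and distribution function; it rests on the infimum being
    attained. *)
Lemma quantile_le u x : (0 < u < 1)%R ->
  (quantile P u <= x)%R = (u <= dist_fun P x)%R.
Proof.
move=> u01; rewrite /quantile u01; case/andP: u01 => u0 u1.
have F0 : dist_fun P y @[y --> -oo%R] --> (0%R : R).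
  apply: fine_cvg; rewrite (_ : (fun y => _) = cdf X) //; exact: cvg_cdfNy0.
have F1 : dist_fun P y @[y --> +oo%R] --> (1%R : R).
  apply: fine_cvg; rewrite (_ : (fun y => _) = cdf X) //; exact: cvg_cdfy1.
have [b Fb] : exists b, (u <= dist_fun P b)%R.
  have := cvgr_ge _ F1 _ u1.
  by move=> [M [_ hM]]; exists (M + 1)%R; apply: hM; rewrite ltrDl.
have [a Fa] : exists a, (dist_fun P a < u)%R.
  have := cvgr_lt _ F0 _ u0.
  by move=> [M [_ hM]]; exists (M - 1)%R; apply: hM; rewrite gtrBl.
have Sinf : has_inf [set x | (u <= dist_fun P x)%R].
  split; [by exists b|exists a => y /= Fy].
  rewrite leNgt; apply/negP => ya.
  by have := dist_fun_nondecreasing (ltW ya); rewrite leNgt (lt_le_trans Fa).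
apply/idP/idP => [|ux]; last exact: (ge_inf Sinf.2).
rewrite le_eqVlt => /predU1P[<-|]; last first.
  move=> /(inf_lt Sinf.1) [y /= uy yx].
  exact: (le_trans uy (dist_fun_nondecreasing (ltW yx))).
(* There remains the case where x is the infimum itself: right continuity transfers the inequality
   from the points to the right of s. *)
set s := inf _.
have rc : dist_fun P y @[y --> s^'+] --> dist_fun P s.
  apply: fine_cvg; rewrite fineK ?fin_num_measure //.
  exact: (@cdf_right_continuous _ _ _ _ X).
apply: (cvgr_to_ge rc); near=> y.
have /(inf_lt Sinf.1)[z /= uz zy] : (s < y)%R by near: y; exact: nbhs_right_gt.
exact: (le_trans uz (dist_fun_nondecreasing (ltW zy))).
Unshelve. all: by end_near. Qed.

(** Inside ]0, 1[, [quantile_le] turns the preimage of ]x, +oo[ into the part above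
    [dist_fun P x]. *)
Lemma measurable_quantile : measurable_fun setT (quantile P).
Proof.
have mI : measurable_fun [set: R] (fun u : R => 0 < u < 1)%R.
  by apply: measurable_and; exact: measurable_fun_ltr.
rewrite /quantile; apply: measurable_fun_if => //.
apply: (measurability (@RGenOInfty.G R)); first exact: RGenOInfty.measurableE.
move=> /= _ [_ [x ->] <-].
rewrite (_ : _ `&` _ = `]0%R, 1%R[%classic `&` `]dist_fun P x, +oo[%classic).
  exact: measurableI.
apply/seteqP; split=> u /=; rewrite !in_itv /= !andbT.
  move=> [[_ u01] q]; split=> //; move: q; rewrite [(_ < u)%R]ltNge -(quantile_le _ u01).
  by rewrite /quantile u01 -ltNge.
move=> [u01]; rewrite ltNge -(quantile_le _ u01) -ltNge /quantile u01 => h.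
by split.
Qed.

End quantile.

Lemma uniform01_ray (R : realType) (a : R) : (0 <= a <= 1)%R ->
  uniform_prob (@ltr01 R) `]a, 1%R[%classic = (1 - a)%:E.
Proof.
move=> /andP[a0 a1]; rewrite /uniform_prob (eq_integral (fun=> 1)).
  rewrite integral_cst //= mul1e lebesgue_measure_itv /= lte_fin.
  move: a1; rewrite le_eqVlt => /predU1P[->|->]; last by rewrite EFinB.
  by rewrite ltxx subrr.
move=> x; rewrite inE /= in_itv /= => /andP[ax x1].
by rewrite /uniform_pdf (ltW x1) (le_trans a0 (ltW ax)) /= subr0 invr1.
Qed.

(** Inverse transform sampling, checked on right rays. *)
Lemma uniform01_quantile (R : realType) (P : probability (measurableTypeR R) R)
    (A : set (measurableTypeR R)) : measurable A ->
  P A = uniform_prob (@ltr01 R) (quantile P @^-1` A).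
Proof.
pose U : probability (measurableTypeR R) R := uniform_prob (@ltr01 R).
have Uray a : (0 <= a <= 1)%R -> U `]a, 1%R[%classic = (1 - a)%:E.
  exact: uniform01_ray.
have mq : measurable_fun setT (quantile P : measurableTypeR R -> measurableTypeR R).
  exact: measurable_quantile.
pose q : {mfun measurableTypeR R >-> measurableTypeR R} :=
  HB.pack (quantile P : measurableTypeR R -> measurableTypeR R)
    (isMeasurableFun.Build _ _ _ _ _ mq).
suff : forall B, measurable B -> P B = distribution U q B by exact.
apply: probability_rayP => x.
have mI : measurable (`]0%R, 1%R[%classic : set (measurableTypeR R)).
  exact: measurable_itv.
have mS : measurable (q @^-1` `]x, +oo[%classic).
  by apply: measurable_preimageT => //; exact: measurable_itv.
(* The complement of ]0, 1[ is null for [U], so the preimage may be cut down to ]0, 1[, where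
   [quantile_le] holds. *)
have UI : U (~` `]0%R, 1%R[%classic) = 0.
  by rewrite probability_setC // Uray ?lexx ?ler01 // subr0 subee.
rewrite [RHS](_ : _ = U ((q @^-1` `]x, +oo[%classic) `&` `]0%R, 1%R[%classic)); last first.
  transitivity (U (q @^-1` `]x, +oo[%classic)); first by [].
  rewrite (measureDI U mS mI) [X in X + _](_ : _ = 0) ?add0e //.
  apply/eqP; rewrite eq_le measure_ge0 andbT -UI.
  by apply: le_measure; rewrite ?inE //; [exact: measurableD|exact: measurableC].
have F01 := conj (dist_fun_ge0 P x) (dist_fun_le1 P x).
have -> : (q @^-1` `]x, +oo[%classic) `&` `]0%R, 1%R[%classic =
    `]dist_fun P x, 1%R[%classic.
  apply/seteqP; split=> u /=; rewrite !in_itv /= !andbT.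
    by move=> [qu u01]; case/andP: (u01) => _ ->; rewrite andbT ltNge -(quantile_le _ _ u01) -ltNge.
  move=> /andP[Fu u1]; have u01 : (0 < u < 1)%R by rewrite u1 (le_lt_trans F01.1).
  by split=> //; rewrite ltNge (quantile_le _ _ u01) -ltNge.
rewrite Uray; last by rewrite F01.1 F01.2.
rewrite EFinB /dist_fun fineK ?fin_num_measure // -probability_setC //.
by rewrite setCitvl.
Qed.

(** Through [quantile_le], the inequalities F' <= F <= F'(. + d) between distribution functions
    become q <= q' <= q + d between quantiles. *)
Lemma quantile_close (R : realType) (P P' : probability (measurableTypeR R) R) (d : R) :
  (0 <= d)%R ->
  (forall x, dist_fun P' x <= dist_fun P x)%R ->
  (forall x, dist_fun P x <= dist_fun P' (x + d))%R ->
  forall u, (`|quantile P u - quantile P' u| <= d)%R.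
Proof.
move=> d0 PP' P'P u; have [u01|u01] := boolP (0 < u < 1)%R; last first.
  by rewrite /quantile (negbTE u01) subrr normr0.
have h1 : (quantile P u <= quantile P' u)%R.
  by rewrite quantile_le // (le_trans _ (PP' _)) // -quantile_le.
have h2 : (quantile P' u <= quantile P u + d)%R.
  by rewrite quantile_le // (le_trans _ (P'P _)) // -quantile_le.
by rewrite distrC ger0_norm ?subr_ge0 // lerBlDl.
Qed.

(** * Truncated normal distributions *)

(* The stochastic order implied by a monotone likelihood ratio, multiplied out
   so as to avoid normalising f and g. *)
Lemma likelihood_ratio_order (R : realType)
    (mu : {measure set (measurableTypeR R) -> \bar R}) (f g : R -> R) :
  measurable_fun setT f -> measurable_fun setT g ->
  (forall x, 0 <= f x)%R -> (forall x, 0 <= g x)%R ->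
  (forall s t, s <= t -> f t * g s <= f s * g t)%R ->
  forall z : R,
  (\int[mu]_(x in `]-oo, z]) (g x)%:E) * (\int[mu]_x (f x)%:E) <=
  (\int[mu]_(x in `]-oo, z]) (f x)%:E) * (\int[mu]_x (g x)%:E).
Proof.
move=> mf mg f0 g0 fg z.
have mEf A : measurable_fun A (fun x => (f x)%:E).
  by apply: measurable_funTS; exact/measurable_EFinP.
have mEg A : measurable_fun A (fun x => (g x)%:E).
  by apply: measurable_funTS; exact/measurable_EFinP.
have ml : measurable (`]-oo, z]%classic : set (measurableTypeR R)) by exact: measurable_itv.
have mr : measurable (`]z, +oo[%classic : set (measurableTypeR R)) by exact: measurable_itv.
have split (h : R -> R) : measurable_fun setT h -> (forall x, 0 <= h x)%R ->
    \int[mu]_x (h x)%:E =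
    \int[mu]_(x in `]-oo, z]) (h x)%:E + \int[mu]_(x in `]z, +oo[) (h x)%:E.
  move=> mh h0; have <- : `]-oo, z]%classic `|` `]z, +oo[%classic = [set: R].
    by rewrite -setCitvl setUv.
  rewrite ge0_integral_setU //=.
  - by apply: measurable_funTS; exact/measurable_EFinP.
  - by move=> x _; rewrite lee_fin.
  - by apply/disj_setPS; rewrite -setCitvl setICr.
rewrite (split f) // (split g) //.
set a := \int[mu]_(x in `]-oo, z]) (f x)%:E; set a' := \int[mu]_(x in `]z, +oo[) (f x)%:E.
set b := \int[mu]_(x in `]-oo, z]) (g x)%:E; set b' := \int[mu]_(x in `]z, +oo[) (g x)%:E.
have ge0 (A : set R) (h : R -> R) : (forall x, 0 <= h x)%R -> 0 <= \int[mu]_(x in A) (h x)%:E.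
  by move=> h0; apply: integral_ge0 => x _; rewrite lee_fin.
have -> : b * (a + a') = b * a + b * a' by apply: ge0_muleDr; exact: ge0.
have -> : a * (b + b') = b * a + a * b'.
  by rewrite [b * a]muleC; apply: ge0_muleDr; exact: ge0.
(* The product of the two lower integrals is common to both sides. What remains pairs points s <= z
   < t, so the hypothesis can be integrated in s and then in t. *)
apply: leeD2l.
have scale (k : \bar R) (h : R -> R) (A : set (measurableTypeR R)) : 0 <= k ->
    measurable A -> measurable_fun setT h -> (forall x, 0 <= h x)%R ->
    k * \int[mu]_(x in A) (h x)%:E = \int[mu]_(x in A) (k * (h x)%:E).
  move=> k0 mA mh h0; rewrite ge0_integralZl //; last by move=> x _; rewrite lee_fin.
  by apply: measurable_funTS; exact/measurable_EFinP.
have le1 t : (z < t)%R -> b * (f t)%:E <= a * (g t)%:E.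
  move=> zt; rewrite [b * _]muleC [a * _]muleC /a /b !scale ?lee_fin//.
  apply: ge0_le_integral => //.
  - by move=> x _; rewrite -EFinM lee_fin mulr_ge0.
  - exact: (emeasurable_funM (measurable_cst _) (mEg _)).
  - exact: (emeasurable_funM (measurable_cst _) (mEf _)).
  - move=> x /=; rewrite in_itv /= => xz.
    by rewrite -!EFinM lee_fin [leRHS]mulrC; apply: fg; rewrite (le_trans xz)// ltW.
rewrite (scale b f) ?ge0// (scale a g) ?ge0//.
apply: ge0_le_integral => //.
- by move=> x _; rewrite mule_ge0 ?lee_fin ?ge0.
- exact: (emeasurable_funM (measurable_cst _) (mEf _)).
- exact: (emeasurable_funM (measurable_cst _) (mEg _)).
- by move=> t /=; rewrite in_itv /= andbT => zt; exact: le1.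
Qed.

Lemma normal_pdf1E (R : realType) (m x : R) :
  normal_pdf m 1 x = (normal_peak 1 * expR (- (x - m) ^+ 2 / 2))%R.
Proof. by rewrite normal_pdfE ?oner_eq0 // /normal_fun expr1n. Qed.

Definition truncated_pdf (R : realType) (eta : R) (b : bool) (x : R) : R :=
  normal_pdf eta 1 x * \1_(@half_line R b) x.

Lemma truncated_pdf_ge0 (R : realType) (eta : R) b x : (0 <= truncated_pdf eta b x)%R.
Proof. by rewrite mulr_ge0 // normal_pdf_ge0. Qed.

Lemma measurable_truncated_pdf (R : realType) (eta : R) b :
  measurable_fun setT (truncated_pdf eta b).
Proof.
apply: measurable_funM; first exact: measurable_normal_pdf.
by apply: measurable_indic; exact: measurable_half_line.
Qed.

Lemma truncated_factorE (R : realType) (eta : R) b (A : set (measurableTypeR R)) :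
  truncated_factor eta b A = \int[lebesgue_measure]_(x in A) (truncated_pdf eta b x)%:E.
Proof.
rewrite /truncated_factor /= /mrestr /normal_prob integral_mkcondr.
apply: eq_integral => x _; rewrite patchE /truncated_pdf indicE.
by case: ifPn => xH; rewrite ?mulr1 ?mulr0.
Qed.

(** The indicators contribute the same product on both sides, and the Gaussian exponents differ by
    (t - s) (eta' - eta) >= 0. *)
Lemma truncated_pdf_ratio (R : realType) (eta eta' : R) b s t :
  (eta <= eta')%R -> (s <= t)%R ->
  (truncated_pdf eta b t * truncated_pdf eta' b s <=
   truncated_pdf eta b s * truncated_pdf eta' b t)%R.
Proof.
move=> ee st; rewrite /truncated_pdf mulrACA [leRHS]mulrACA.
rewrite [(\1__ t * _)%R]mulrC ler_wpM2r ?mulr_ge0 //.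
rewrite !normal_pdf1E mulrACA [leRHS]mulrACA -!expRD.
rewrite ler_wpM2l ?mulr_ge0 ?normal_peak_ge0 // ler_expR.
rewrite -subr_ge0 (_ : _ - _ = (t - s) * (eta' - eta))%R; last by field.
by rewrite mulr_ge0 // subr_ge0.
Qed.

(** The normal density of mean eta at x - d is that of mean eta + d at x. The Gaussian factors
    therefore agree, and the claim concerns only the indicators of the half-line and of its
    translate. *)
Lemma truncated_pdf_shift_ratio (R : realType) (eta d : R) b s t :
  (0 <= d)%R -> (s <= t)%R ->
  (truncated_pdf (eta + d) b t * truncated_pdf eta b (s - d) <=
   truncated_pdf (eta + d) b s * truncated_pdf eta b (t - d))%R.
Proof.
move=> d0 st; have pdfE x : (normal_pdf eta 1 (x - d) = normal_pdf (eta + d) 1 x)%R.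
  by rewrite !normal_pdf1E -addrA -opprD [(d + eta)%R]addrC.
rewrite /truncated_pdf !pdfE mulrACA [leRHS]mulrACA [(normal_pdf _ _ t * _)%R]mulrC.
rewrite ler_wpM2l ?mulr_ge0 ?normal_pdf_ge0 // !indicE -!natrM ler_nat !mulnb.
have : ((t \in @half_line R b) && (s - d \in @half_line R b) ->
       (s \in @half_line R b) && (t - d \in @half_line R b))%R.
  rewrite /half_line; case: b; rewrite !mem_setE !in_itv /= ?andbT;
  by move=> /andP[h1 h2]; apply/andP; split; lra.
by case: (_ && _) => // ->.
Qed.

(** The half-line contains ]0, 1] or ]-1, 0], where |x - eta| <= |eta| + 1 bounds the density below
    by [c]. *)
Lemma truncated_factor_gt0 (R : realType) (eta : R) b : 0 < truncated_factor eta b setT.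
Proof.
pose a : R := if b then 0%R else (- 1)%R.
pose c : R := (normal_peak 1 * expR (- (`|eta| + 1) ^+ 2 / 2))%R.
have c0 : (0 < c)%R by rewrite mulr_gt0 ?expR_gt0 // normal_peak_gt0 // oner_eq0.
have lea : 0 < \int[lebesgue_measure]_(x in `]a, (a + 1)%R] : set R) c%:E.
  rewrite integral_cst //= lebesgue_measure_itv /= lte_fin ltrDl ltr01.
  by rewrite -EFinB addrAC subrr add0r mule1 lte_fin.
apply: (lt_le_trans lea); rewrite truncated_factorE.
have mE A : measurable_fun A (fun x => (truncated_pdf eta b x)%:E).
  by apply: measurable_funTS; apply/measurable_EFinP; exact: measurable_truncated_pdf.
apply: (@le_trans _ _
  (\int[lebesgue_measure]_(x in `]a, (a + 1)%R] : set R) (truncated_pdf eta b x)%:E)); last first.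
  apply: ge0_subset_integral => //; first exact: mE.
  by move=> x _; rewrite lee_fin truncated_pdf_ge0.
apply: ge0_le_integral => //; [by move=> x _; rewrite lee_fin ltW|exact: mE|].
move=> x /=; rewrite in_itv /= => /andP[ax xa].
have xH : x \in @half_line R b.
  by rewrite /half_line; move: ax xa; rewrite /a; case: (b) => ? ?;
  rewrite mem_setE in_itv /= ?andbT; lra.
rewrite lee_fin /truncated_pdf indicE xH mulr1 normal_pdf1E ler_wpM2l ?normal_peak_ge0 //.
rewrite ler_expR !mulNr lerN2 ler_wpM2r ?invr_ge0 // -(real_normK (num_real (x - eta))).
rewrite ler_sqr ?nnegrE ?addr_ge0 // (le_trans (ler_normB _ _)) // addrC lerD2l.
by rewrite ler_norml; move: ax xa; rewrite /a; case: (b); lra.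
Qed.

Lemma truncated_factor_fin (R : realType) (eta : R) b :
  truncated_factor eta b setT \is a fin_num.
Proof. exact: fin_num_measure. Qed.

Definition truncated_normal (R : realType) (eta : R) (b : bool) :
    probability (measurableTypeR R) R :=
  mnormalize (truncated_factor eta b) (dirac (0%R : measurableTypeR R)).

Lemma mnormalizeE (R : realType) d (T : measurableType d)
    (mu : {measure set T -> \bar R}) (P : probability T R) (A : set T) :
  0 < mu setT -> mu setT \is a fin_num ->
  mnormalize mu P A = (fine (mu setT))^-1%:E * mu A.
Proof.
move=> mu0 mufin; rewrite /mnormalize gt_eqF //=.
by have [mu_oo|_] := eqVneq (mu setT) +oo; [rewrite mu_oo in mufin|rewrite muleC].
Qed.

Lemma truncated_normalE (R : realType) (eta : R) b (A : set (measurableTypeR R)) :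
  truncated_normal eta b A =
  (fine (truncated_factor eta b setT))^-1%:E * truncated_factor eta b A.
Proof. exact: (mnormalizeE _ _ (truncated_factor_gt0 _ _) (truncated_factor_fin _ _)). Qed.

(** Turns a cross-multiplied inequality, as produced by [likelihood_ratio_order], into one between
    normalised masses. *)
Lemma normalized_le (R : realType) d (T : measurableType d)
    (m m' : {finite_measure set T -> \bar R}) (A A' : set T) :
  measurable A -> measurable A' -> 0 < m setT -> 0 < m' setT ->
  m' A' * m setT <= m A * m' setT ->
  (fine ((fine (m' setT))^-1%:E * m' A') <= fine ((fine (m setT))^-1%:E * m A))%R.
Proof.
move=> mA mA' m0 m'0.
have finE (k : {finite_measure set T -> \bar R}) B : measurable B -> k B = (fine (k B))%:E.
  by move=> mB; rewrite fineK // fin_num_measure.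
have fine0 (k : {finite_measure set T -> \bar R}) : 0 < k setT -> (0 < fine (k setT))%R.
  by move=> k0; rewrite -lte_fin -finE.
rewrite (finE m A) // (finE m' A') // (finE m setT) // (finE m' setT) // -!EFinM lee_fin /=.
rewrite ler_pdivrMl ?fine0 // mulrCA ler_pdivlMl ?fine0 // => h.
by rewrite mulrC [leRHS]mulrC.
Qed.

Lemma truncated_normal_dist_le (R : realType) (eta eta' : R) b (z z' : R) :
  truncated_factor eta' b `]-oo, z']%classic * truncated_factor eta b setT <=
  truncated_factor eta b `]-oo, z]%classic * truncated_factor eta' b setT ->
  (dist_fun (truncated_normal eta' b) z' <= dist_fun (truncated_normal eta b) z)%R.
Proof.
rewrite /dist_fun !truncated_normalE; apply: normalized_le => //;
exact: truncated_factor_gt0.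
Qed.

Lemma truncated_normal_quantile_close (R : realType) (eta eta' : R) b u :
  (`|quantile (truncated_normal eta b) u - quantile (truncated_normal eta' b) u|
    <= `|eta - eta'|)%R.
Proof.
wlog ee : eta eta' / (eta <= eta')%R.
  move=> h; have [/h//|/ltW/h] := leP eta eta'.
  by move=> ee'; rewrite distrC [leRHS]distrC.
pose d := (eta' - eta)%R; have d0 : (0 <= d)%R by rewrite subr_ge0.
have -> : (`|eta - eta'| = d)%R by rewrite distrC ger0_norm.
have -> : eta' = (eta + d)%R by rewrite addrC subrK.
clearbody d.
apply: (quantile_close d0) => x; apply: truncated_normal_dist_le.
  rewrite !truncated_factorE; apply: likelihood_ratio_order.
  - exact: measurable_truncated_pdf.
  - exact: measurable_truncated_pdf.
  - by move=> ?; exact: truncated_pdf_ge0.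
  - by move=> ?; exact: truncated_pdf_ge0.
  - by move=> s t; apply: truncated_pdf_ratio; rewrite lerDl.
(* The second goal compares the truncated normal at [eta + d] with the translate by d of the one at
   [eta], whose unnormalised density is y -> [truncated_pdf eta b (y - d)]. *)
have mshift : measurable_fun [set: measurableTypeR R] (fun y => (y + d)%R : measurableTypeR R).
  by apply: measurable_funD => //; exact: measurable_id.
have mg : measurable_fun setT (fun y : R => truncated_pdf eta b (y - d)%R).
  apply: measurableT_comp; first exact: measurable_truncated_pdf.
  by apply: measurable_funB => //; exact: measurable_id.
have shiftE (D : set (measurableTypeR R)) : measurable D ->
    \int[lebesgue_measure]_(y in D) (truncated_pdf eta b (y - d)%R)%:E =
    truncated_factor eta b ((fun y => y + d)%R @^-1` D).
  move=> mD; rewrite (ge0_integral_image mshift (lebesgue_measure_translate d)) //; first last.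
  - by move=> y; rewrite lee_fin truncated_pdf_ge0.
  - by apply: measurable_funTS; exact/measurable_EFinP.
  by rewrite truncated_factorE; apply: eq_integral => y _; rewrite addrK.
have -> : `]-oo, x]%classic = (fun y => y + d)%R @^-1` `]-oo, (x + d)%R]%classic.
  by apply/seteqP; split=> y /=; rewrite !in_itv /= lerD2r.
have -> : truncated_factor eta b setT =
  \int[lebesgue_measure]_y (truncated_pdf eta b (y - d)%R)%:E.
  by rewrite shiftE.
rewrite -shiftE // !truncated_factorE; apply: likelihood_ratio_order => //.
- exact: measurable_truncated_pdf.
- by move=> ?; exact: truncated_pdf_ge0.
- by move=> ?; exact: truncated_pdf_ge0.
- by move=> s t; exact: truncated_pdf_shift_ratio.
Qed.

(* The loss of 1 with respect to the exact change of variables formula comes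
   from rounding g on the shells [k, k + 1[. *)
Lemma integral_density_le (R : realType) d (T : measurableType d)
    (mu nu : {measure set T -> \bar R}) (f g : T -> R) :
  measurable_fun setT f -> measurable_fun setT g ->
  (forall x, 0 <= f x)%R -> (forall x, 0 <= g x)%R ->
  (forall A, measurable A -> nu A = \int[mu]_(x in A) (f x)%:E) ->
  \int[nu]_x (g x)%:E <= \int[mu]_x ((g x + 1) * f x)%:E.
Proof.
move=> mf mg f0 g0 nuE; pose S (k : nat) := g @^-1` `[k%:R, k.+1%:R[%classic.
have mS k : measurable (S k) by apply: measurable_preimageT => //; exact: measurable_itv.
have ST : \bigcup_k S k = setT.
  rewrite -subTset => x _; exists (Num.truncn (g x)) => //=.
  by rewrite /S /= in_itv /= truncn_itv.
have tS : trivIset setT S.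
  apply: ltn_trivIset => i j ij; rewrite -subset0 => x /= [].
  rewrite /S /= !in_itv /= => /andP[_ gx] /andP[gx' _].
  by move: (le_lt_trans gx' gx); rewrite ltr_nat ltnS leqNgt ij.
have mE (h : T -> R) A : measurable_fun setT h -> measurable_fun A (EFin \o h).
  by move=> mh; apply: measurable_funTS; exact/measurable_EFinP.
have mgf : measurable_fun setT (fun x => (g x + 1) * f x)%R.
  by apply: measurable_funM => //; exact: measurable_funD.
have shells (m : {measure set T -> \bar R}) (h : T -> R) : measurable_fun setT h ->
    (forall x, 0 <= h x)%R ->
    \int[m]_x (h x)%:E = \sum_(k <oo) \int[m]_(x in S k) (h x)%:E.
  move=> mh h0; rewrite -ST ge0_integral_bigcup //; first exact: mE.
  by move=> x _; rewrite lee_fin.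
rewrite (shells nu) // (shells mu) //; last first.
  by move=> x; rewrite mulr_ge0 // addr_ge0.
apply: lee_nneseries => [k _ _|k _]; first by apply: integral_ge0 => x _; rewrite lee_fin.
apply: (@le_trans _ _ (\int[nu]_(x in S k) k.+1%:R%:E)).
  apply: ge0_le_integral => //.
  - by move=> x _; rewrite lee_fin.
  - exact: mE.
  - by move=> x; rewrite /S /= in_itv /= lee_fin => /andP[_ /ltW].
rewrite integral_cst // nuE // -ge0_integralZl //; first last.
- by move=> x _; rewrite lee_fin.
- exact: mE.
apply: ge0_le_integral => //.
- by move=> x _; rewrite -EFinM lee_fin mulr_ge0.
- by apply: emeasurable_funM => //; exact: mE.
- exact: mE.
- move=> x; rewrite /S /= in_itv /= => /andP[kg _].
  by rewrite -EFinM lee_fin ler_wpM2r // -natr1 lerD2r.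
Qed.

Lemma integral_mnormalize (R : realType) d (T : measurableType d)
    (mu : {measure set T -> \bar R}) (P : probability T R) (f : T -> \bar R) :
  0 < mu setT -> mu setT \is a fin_num -> measurable_fun setT f ->
  (forall x, 0 <= f x) ->
  \int[mnormalize mu P]_x f x = (fine (mu setT))^-1%:E * \int[mu]_x f x.
Proof.
move=> mu0 mufin mf f0; have c0 : (0 <= (fine (mu setT))^-1)%R by rewrite invr_ge0 fine_ge0.
rewrite -[RHS](@ge0_integral_mscale _ T R mu setT measurableT (NngNum c0)) //.
apply: eq_measure_integral => A mA _; exact: mnormalizeE.
Qed.

Lemma measurable_gauss (R : realType) (c m : R) :
  measurable_fun setT (fun x : R => expR (- (c * (x - m) ^+ 2)))%R.
Proof.
apply: measurableT_comp => //; apply: measurableT_comp => //.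
apply: measurable_funM => //; apply: measurable_funX.
by apply: measurable_funB => //; exact: measurable_id.
Qed.

(** The integrand is the normal density of mean m and variance 1 / (2 c), divided by its peak
    value. *)
Lemma integral_gauss (R : realType) (c m : R) : (0 < c)%R ->
  \int[lebesgue_measure]_x (expR (- (c * (x - m) ^+ 2)))%:E =
  (normal_peak (Num.sqrt (2 * c)^-1))^-1%:E.
Proof.
move=> c0; set s := Num.sqrt _.
have s2 : (s ^+ 2 = (2 * c)^-1)%R by rewrite sqr_sqrtr // invr_ge0 mulr_ge0 // ltW.
have s0 : s != 0%R by rewrite gt_eqF // sqrtr_gt0 invr_gt0 mulr_gt0.
have pk := normal_peak_gt0 s0.
have -> : \int[lebesgue_measure]_x (expR (- (c * (x - m) ^+ 2)))%:E =
    \int[lebesgue_measure]_x ((normal_peak s)^-1%:E * (normal_pdf m s x)%:E).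
  apply: eq_integral => x _; rewrite -EFinM normal_pdfE // mulKf ?gt_eqF //.
  congr (expR _)%:E; rewrite s2 mulNr; congr (- _)%R.
  by field; rewrite gt_eqF.
rewrite ge0_integralZl //.
- by rewrite integral_normal_pdf mule1.
- by apply/measurable_EFinP; exact: measurable_normal_pdf.
- by move=> x _; rewrite lee_fin normal_pdf_ge0.
- by rewrite lee_fin invr_ge0 ltW.
Qed.

(* From w <= (2 / c) exp (c w / 2), applied to w = (x - m)^2. *)
Lemma sqr_gauss_le (R : realType) (c m x : R) : (0 < c)%R ->
  ((x ^+ 2 + 1) * expR (- (c * (x - m) ^+ 2)) <=
   (4 / c + 2 * m ^+ 2 + 1) * expR (- (c / 2 * (x - m) ^+ 2)))%R.
Proof.
move=> c0; set w := ((x - m) ^+ 2)%R; have w0 : (0 <= w)%R by exact: sqr_ge0.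
have -> : (- (c * w) = - (c / 2 * w) + - (c / 2 * w))%R by field.
rewrite expRD mulrA ler_wpM2r ?expR_ge0 //.
set e := expR (- _); have e0 : (0 < e)%R by exact: expR_gt0.
have e1 : (e <= 1)%R.
  by rewrite -expR0 ler_expR oppr_le0 mulr_ge0 // divr_ge0 // ltW.
have we : (w * e <= 2 / c)%R.
  rewrite /e expRN ler_pdivrMr ?expR_gt0 //.
  rewrite [leLHS](_ : w = 2 / c * (c / 2 * w))%R; last by field; rewrite gt_eqF.
  rewrite ler_wpM2l ?divr_ge0 ?(ltW c0) //.
  by apply: le_trans (expR_ge1Dx _); rewrite lerDr.
have xw : (x ^+ 2 <= 2 * w + 2 * m ^+ 2)%R.
  rewrite -subr_ge0 (_ : _ - _ = (x - 2 * m) ^+ 2)%R; last by rewrite /w; ring.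
  exact: sqr_ge0.
have m0 : (0 <= 2 * m ^+ 2 + 1)%R by rewrite addr_ge0 // mulr_ge0 // sqr_ge0.
apply: (@le_trans _ _ ((2 * w + (2 * m ^+ 2 + 1)) * e)%R).
  by rewrite ler_pM2r // addrA lerD2r.
rewrite mulrDl -addrA lerD //; last by rewrite ler_piMr.
by rewrite -mulrA (_ : 4 / c = 2 * (2 / c))%R ?ler_pM2l //; field; rewrite gt_eqF.
Qed.

Lemma integral_sqr_truncated_normal (R : realType) (eta : R) b :
  \int[truncated_normal eta b]_x (x ^+ 2)%:E < +oo.
Proof.
have msqr : measurable_fun setT (fun x : R => x ^+ 2)%R by exact: measurable_funX.
rewrite integral_mnormalize; first last.
- by move=> x; rewrite lee_fin sqr_ge0.
- exact/measurable_EFinP.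
- exact: truncated_factor_fin.
- exact: truncated_factor_gt0.
rewrite lte_mul_pinfty // ?lee_fin ?invr_ge0 ?fine_ge0 //.
have := @integral_density_le R _ (measurableTypeR R) lebesgue_measure
  (truncated_factor eta b) _ _ (measurable_truncated_pdf eta b) msqr
  (truncated_pdf_ge0 eta b) (fun x => sqr_ge0 x) (fun A _ => truncated_factorE eta b A).
move=> /le_lt_trans; apply.
(* [K] and the [c] below are the constant and the halved exponent that [sqr_gauss_le] gives for the
   exponent 1/2 of the normal density. *)
pose K := (4 / 2^-1 + 2 * eta ^+ 2 + 1 : R)%R.
have K0 : (0 <= K)%R.
  by rewrite /K !addr_ge0 ?divr_ge0 ?invr_ge0 // mulr_ge0 // sqr_ge0.
pose c : R := (2^-1 / 2)%R.
have c0 : (0 < c)%R by rewrite divr_gt0 // invr_gt0.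
have mgauss := measurable_gauss c eta.
apply: (@le_lt_trans _ _ (\int[lebesgue_measure]_x
   ((normal_peak 1 * K)%:E * (expR (- (c * (x - eta) ^+ 2)))%:E))).
  apply: ge0_le_integral => //.
  - move=> x _; rewrite lee_fin mulr_ge0 ?truncated_pdf_ge0 //.
    by rewrite addr_ge0 // sqr_ge0.
  - apply/measurable_EFinP; apply: measurable_funM; last exact: measurable_truncated_pdf.
    by apply: measurable_funD.
  - by apply: emeasurable_funM => //; exact/measurable_EFinP.
  - move=> x _; rewrite -EFinM lee_fin /truncated_pdf normal_pdf1E.
    apply: (@le_trans _ _ (normal_peak 1 * ((x ^+ 2 + 1) * expR (- (2^-1 * (x - eta) ^+ 2))))%R).
      rewrite mulNr [(_ / 2)%R]mulrC [leRHS]mulrCA ler_wpM2l ?addr_ge0 ?sqr_ge0 //.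
      apply: ler_piMr; first by rewrite mulr_ge0 ?expR_ge0 ?normal_peak_ge0.
      by rewrite indicE lern1 leq_b1.
    by rewrite -mulrA ler_wpM2l ?normal_peak_ge0 //; apply: sqr_gauss_le; rewrite invr_gt0.
rewrite ge0_integralZl //.
- by rewrite integral_gauss // -EFinM ltry.
- exact/measurable_EFinP.
- by rewrite lee_fin mulr_ge0 ?normal_peak_ge0.
Qed.

(** * Wasserstein distance of products of truncated normals *)

Lemma prod_measure_setT (R : realType) (n : nat)
    (m : 'I_n -> {sigma_finite_measure set (measurableTypeR R) -> \bar R}) :
  prod_measure m setT = \big[*%E/1]_i m i setT.
Proof.
have := @integral_prod_measure_prod R n m (fun _ _ => 1%R).
move=> /(_ (fun _ => measurable_cst _) (fun _ _ => ler01)).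
under eq_integral do rewrite prodr_const expr1n.
rewrite integral_cst // mul1e => ->; apply: eq_bigr => i _.
by rewrite integral_cst // mul1e.
Qed.

Lemma prod_probability_setT (R : realType) (n : nat)
    (P : 'I_n -> probability (measurableTypeR R) R) :
  prod_measure P setT = 1.
Proof. by rewrite prod_measure_setT big1 // => i _; exact: probability_setT. Qed.

Section probability_pack.
Context (R : realType) d (T : measurableType d).
Variables (mu : {measure set T -> \bar R}) (mu1 : mu setT = 1).

(** The device of [sigma_finite_pack], for measures of total mass 1. *)
Definition probability_pack of mu setT = 1 : set T -> \bar R := mu.

HB.instance Definition _ := Measure.on (probability_pack mu1).

HB.instance Definition _ :=
  Measure_isProbability.Build d T R (probability_pack mu1) mu1.

End probability_pack.

Lemma uniform_cube_setT (R : realType) (n : nat) :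
  prod_measure (fun _ : 'I_n => uniform_prob (@ltr01 R)) setT = 1.
Proof. exact: (prod_probability_setT (fun=> uniform_prob (@ltr01 R))). Qed.

(** The common source of randomness from which the latent laws are sampled, and thereby coupled. *)
Definition uniform_cube (R : realType) (n : nat) : probability (n.-tuple R) R :=
  probability_pack (uniform_cube_setT R n).

(* [update1 X y mu2] unfolds to [latent y (X *m mean mu2)]. *)
Definition latent (R : realType) (n : nat) (y : n.-tuple bool) (v : 'cV[R]_n) :
    probability (n.-tuple R) R :=
  mnormalize (prod_measure (fun i => truncated_factor (v i ord0) (tnth y i)))
    (dirac (origin R n)).

(** The mass of a product is the product of the masses, so normalising the product amounts to
    normalising each factor. *)
Lemma latentE (R : realType) (n : nat) (y : n.-tuple bool) (v : 'cV[R]_n)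
    (A : set (n.-tuple R)) : measurable A ->
  latent y v A = prod_measure (fun i => truncated_normal (v i ord0) (tnth y i)) A.
Proof.
move=> mA; pose m i := truncated_factor (v i ord0) (tnth y i).
have M0 i : (0 < fine (m i setT))%R.
  by apply: fine_gt0; rewrite truncated_factor_gt0 /= -ge0_fin_numE ?truncated_factor_fin.
pose c i : {nonneg R} := NngNum (ltW (M0 i)).
have cE B : measurable B -> prod_measure m B = (\prod_i (c i)%:num)%:E *
    prod_measure (fun i => truncated_normal (v i ord0) (tnth y i)) B.
  move=> mB; apply: prod_measure_scale => // i D mD.
  rewrite [X in _ = _ * X]truncated_normalE muleA -EFinM /= divff ?gt_eqF ?mul1e //.
  exact: M0.
have c0 : (0 < \prod_i (c i)%:num)%R by apply: prodr_gt0 => i _; exact: M0.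
have mT : prod_measure m setT = (\prod_i (c i)%:num)%:E.
  rewrite cE // [X in _ * X](prod_probability_setT
    (fun i => truncated_normal (v i ord0) (tnth y i))).
  by rewrite mule1.
transitivity ((fine (prod_measure m setT))^-1%:E * prod_measure m A).
  by apply: mnormalizeE; rewrite mT ?lte_fin.
by rewrite mT cE // muleA -EFinM /= mulVf ?mul1e // gt_eqF.
Qed.

Lemma latent_quantile (R : realType) (n : nat) (y : n.-tuple bool) (v : 'cV[R]_n)
    (A : set (n.-tuple R)) : measurable A ->
  latent y v A = uniform_cube R n
    (tuple_map (fun i => quantile (truncated_normal (v i ord0) (tnth y i))) @^-1` A).
Proof.
move=> mA; rewrite latentE //; apply: prod_measure_map => //.
- by move=> i; exact: measurable_quantile.
- by move=> i B mB; exact: uniform01_quantile.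
Qed.

Lemma measurable_sqsum (R : realType) (n : nat) :
  measurable_fun setT (fun x : n.-tuple R => (\sum_(i < n) tnth x i ^+ 2)%R).
Proof.
by apply: measurable_sum => i; apply: measurable_funX; exact: measurable_tnth.
Qed.

Lemma latent_finite_second_moment (R : realType) (n : nat) (y : n.-tuple bool)
    (v : 'cV[R]_n) : finite_second_moment (latent y v).
Proof.
rewrite /finite_second_moment.
pose P i := truncated_normal (v i ord0) (tnth y i).
have -> : \int[latent y v]_x (\sum_(i < n) tnth x i ^+ 2)%:E =
    \int[prod_measure P]_x (\sum_(i < n) tnth x i ^+ 2)%:E.
  by apply: eq_measure_integral => A mA _; exact: latentE.
under eq_integral do rewrite -sumEFin.
rewrite ge0_integral_sum //; first last.
- by move=> i x _; rewrite lee_fin sqr_ge0.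
- move=> i; apply/measurable_EFinP; apply: measurable_funX.
  exact: measurable_tnth.
apply: lte_sum_pinfty => i _.
(* The square of coordinate i becomes a product over all coordinates, with factor 1 away from i, as
   [integral_prod_measure_prod] expects. *)
pose g j (x : R) := if j == i then (x ^+ 2)%R else 1%R.
have g0 j x : (0 <= g j x)%R by rewrite /g; case: ifP => // _; exact: sqr_ge0.
have mg j : measurable_fun setT (g j).
  by rewrite /g; case: (j == i) => //; exact: measurable_funX.
have -> : \int[prod_measure P]_x (tnth x i ^+ 2)%:E =
    \int[prod_measure P]_x (\prod_j g j (tnth x j))%:E.
  apply: eq_integral => x _; rewrite (bigD1 i) //= {1}/g eqxx big1 ?mulr1 //.
  by move=> j /negbTE ji; rewrite /g ji.
rewrite (integral_prod_measure_prod _ mg g0).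
rewrite ltey_eq; apply/orP; left.
apply: (big_ind (fun x => x \is a fin_num)) => // [x z xf zf|j _].
  exact: fin_numM.
rewrite ge0_fin_numE; last by apply: integral_ge0 => x _; rewrite lee_fin.
rewrite /g; case: (j =P i) => [->|_]; first exact: integral_sqr_truncated_normal.
rewrite integral_cst // mul1e.
exact: (le_lt_trans (probability_le1 (P j) measurableT) (ltry _)).
Qed.

Lemma measurable_sqdist (R : realType) (n : nat) :
  measurable_fun setT (fun u : n.-tuple R * n.-tuple R => (sqdist u.1 u.2)%:E).
Proof.
apply/measurable_EFinP; apply: measurable_sum => i; apply: measurable_funX.
apply: measurable_funB.
  exact: (measurableT_comp (measurable_tnth i) measurable_fst).
exact: (measurableT_comp (measurable_tnth i) measurable_snd).
Qed.

Lemma sqdist_ge0 (R : realType) (n : nat) (x z : n.-tuple R) : (0 <= sqdist x z)%R.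
Proof. by apply: sumr_ge0 => i _; exact: sqr_ge0. Qed.

Lemma wasserstein2E (R : realType) (n : nat) (mu nu : probability (n.-tuple R) R) :
  wasserstein2 mu nu = sqrte (ereal_inf
    [set \int[g]_u (sqdist u.1 u.2)%:E | g in coupling mu nu]).
Proof.
rewrite /wasserstein2 poweR12_sqrt //; apply: le_ereal_inf_tmp => _ [g _ <-].
by apply: integral_ge0 => u _; rewrite lee_fin sqdist_ge0.
Qed.

(** The law of (f, g) under [P] is a coupling, and the pointwise bound on the squared distance
    bounds its cost. *)
Lemma wasserstein2_le (R : realType) (n : nat) d (T : measurableType d)
    (P : probability T R) (f g : T -> n.-tuple R)
    (mu nu : probability (n.-tuple R) R) (c : R) :
  measurable_fun setT f -> measurable_fun setT g ->
  (forall A, measurable A -> mu A = P (f @^-1` A)) ->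
  (forall A, measurable A -> nu A = P (g @^-1` A)) ->
  (0 <= c)%R -> (forall x, sqdist (f x) (g x) <= c)%R ->
  wasserstein2 mu nu <= (Num.sqrt c)%:E.
Proof.
move=> mf mg muE nuE c0 fgc.
have mfg : measurable_fun setT (fun x => (f x, g x)) by exact/measurable_fun_pairP.
pose h : {mfun T >-> (n.-tuple R * n.-tuple R)%type} :=
  HB.pack (fun x => (f x, g x)) (isMeasurableFun.Build _ _ _ _ _ mfg).
have hc : coupling mu nu (distribution P h).
  move=> A mA; rewrite muE // nuE //; split; congr (P _).
    by apply/seteqP; split=> x //= [].
  by apply/seteqP; split=> x //= [].
rewrite wasserstein2E -[leRHS]/(sqrte c%:E) lee_sqrt ?lee_fin //.
apply: (@le_trans _ _ (\int[distribution P h]_u (sqdist u.1 u.2)%:E)).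
  by apply: ereal_inf_lbound; exists (distribution P h).
rewrite (@ge0_integral_image _ _ _ _ _ P _ h setT) //; first last.
- by move=> u; rewrite lee_fin sqdist_ge0.
- exact: measurable_sqdist.
rewrite preimage_setT; apply: (@le_trans _ _ (\int[P]_x c%:E)).
  apply: ge0_le_integral => //.
  - by move=> x _; rewrite lee_fin sqdist_ge0.
  - exact: (measurableT_comp (@measurable_sqdist R n) mfg).
  - by move=> x _; rewrite lee_fin; exact: fgc.
by rewrite integral_cst //= probability_setT mule1.
Qed.

Lemma integral_image (R : realType) d1 d2 (T1 : measurableType d1)
    (T2 : measurableType d2) (mu : {measure set T1 -> \bar R})
    (nu : {measure set T2 -> \bar R}) (f : T1 -> T2) (g : T2 -> \bar R) :
  measurable_fun setT f ->
  (forall A, measurable A -> nu A = mu (f @^-1` A)) ->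
  nu.-integrable setT g ->
  mu.-integrable setT (g \o f) /\ \int[nu]_x g x = \int[mu]_x g (f x).
Proof.
move=> mf nuE /integrableP[mg gint].
have gf : mu.-integrable setT (g \o f).
  apply/integrableP; split; first exact: measurableT_comp.
  move: gint; rewrite (ge0_integral_image mf nuE) ?preimage_setT //.
  exact: measurableT_comp.
split=> //.
have := @integral_pushforward _ _ _ _ _ _ mf mu setT g mg.
rewrite preimage_setT => /(_ gf measurableT) <-.
have mf' := mf; apply: eq_measure_integral => // A mA _; exact: nuE.
Qed.

Lemma integrable_tnth (R : realType) (n : nat) (mu : probability (n.-tuple R) R) i :
  finite_second_moment mu -> mu.-integrable setT (fun x => (tnth x i)%:E).
Proof.
move=> mu2; apply/integrableP; split; first by apply/measurable_EFinP; exact: measurable_tnth.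
apply: (@le_lt_trans _ _ (\int[mu]_x (1 + (\sum_(i < n) tnth x i ^+ 2)%:E))).
  apply: ge0_le_integral => //.
  - by apply: measurableT_comp => //; apply/measurable_EFinP; exact: measurable_tnth.
  - by apply: emeasurable_funD => //; apply/measurable_EFinP; exact: measurable_sqsum.
  - move=> x _; rewrite abse_EFin -EFinD lee_fin (bigD1 i) //=.
    rewrite addrA ler_wpDr ?sumr_ge0 // => [j _|]; first exact: sqr_ge0.
    rewrite -(real_normK (num_real (tnth x i))); nra.
rewrite ge0_integralD //; first last.
- by apply/measurable_EFinP; exact: measurable_sqsum.
- by move=> x _; rewrite lee_fin sumr_ge0 // => j _; exact: sqr_ge0.
by rewrite integral_cst //= probability_setT mul1e lte_add_pinfty // ltry.
Qed.

(** Jensen: with c the mean of D, the tangent 2 c D - c^2 lies below D^2 and integrates to c^2. *)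
Lemma sqr_Rintegral_le (R : realType) d (T : measurableType d) (P : probability T R)
    (D : T -> R) : P.-integrable setT (EFin \o D) ->
  ((\int[P]_x D x) ^+ 2)%:E <= \int[P]_x (D x ^+ 2)%:E.
Proof.
move=> Dint; set c := (\int[P]_x D x)%R.
have [->|Dfin] := eqVneq (\int[P]_x (D x ^+ 2)%:E) +oo; first by rewrite leey.
have mD : measurable_fun setT D by apply/measurable_EFinP; exact: (measurable_int P).
have D2int : P.-integrable setT (EFin \o (fun x => D x ^+ 2)%R).
  apply/integrableP; split; first by apply/measurable_EFinP; exact: measurable_funX.
  under eq_integral do rewrite /= ger0_norm ?sqr_ge0 //.
  by rewrite ltey.
have cint k : P.-integrable setT (EFin \o cst k).
  by apply: finite_measure_integrable_cst.
have cDint : P.-integrable setT (EFin \o (fun x => 2 * c * D x)%R).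
  exact: (integrableZl measurableT (2 * c)%R Dint).
have : (\int[P]_x (2 * c * D x - c ^+ 2) <= \int[P]_x (D x ^+ 2))%R.
  apply: le_Rintegral => //.
    exact: (integrableB measurableT cDint (cint (c ^+ 2)%R)).
  move=> x _; have := sqr_ge0 (D x - c); nra.
rewrite (RintegralB measurableT cDint (cint (c ^+ 2)%R)).
rewrite (RintegralZl _ measurableT Dint) Rintegral_cst //= probability_setT /= mulr1 -/c => h.
rewrite -[leRHS]fineK; last first.
  by rewrite ge0_fin_numE ?ltey //; apply: integral_ge0 => x _; rewrite lee_fin sqr_ge0.
by rewrite lee_fin (le_trans _ h) // le_eqVlt; apply/orP; left; apply/eqP; ring.
Qed.

(** Under any coupling the difference of the means is the integral of the coordinate differences,
    and Jensen bounds its square by the cost, coordinate by coordinate. *)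
Lemma wasserstein2_ge (R : realType) (n : nat) (mu nu : probability (n.-tuple R) R) :
  finite_second_moment mu -> finite_second_moment nu ->
  (Num.sqrt (sqnorm (mean mu - mean nu)))%:E <= wasserstein2 mu nu.
Proof.
move=> mu2 nu2; rewrite wasserstein2E -[leLHS]/(sqrte (sqnorm _)%:E).
have inf_ge : (sqnorm (mean mu - mean nu))%:E <= ereal_inf
    [set \int[g]_u (sqdist u.1 u.2)%:E | g in coupling mu nu].
  apply: le_ereal_inf_tmp => _ [g gc <-].
  have muE A : measurable A -> mu A = g (fst @^-1` A).
    move=> mA; rewrite -(gc A mA).1; congr (g _).
    by apply/seteqP; split=> x //= [].
  have nuE A : measurable A -> nu A = g (snd @^-1` A).
    move=> mA; rewrite -(gc A mA).2; congr (g _).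
    by apply/seteqP; split=> x //= [].
  rewrite /sqdist; under eq_integral do rewrite -sumEFin.
  have mc i : measurable_fun setT
      (fun u : n.-tuple R * n.-tuple R => tnth u.1 i - tnth u.2 i)%R.
    apply: measurable_funB.
      exact: (measurableT_comp (measurable_tnth i) measurable_fst).
    exact: (measurableT_comp (measurable_tnth i) measurable_snd).
  rewrite ge0_integral_sum //; first last.
  - by move=> i u _; rewrite lee_fin sqr_ge0.
  - by move=> i; apply/measurable_EFinP; apply: measurable_funX.
  rewrite /sqnorm -sumEFin; apply: lee_sum => i _.
  have [int1 E1] := integral_image measurable_fst muE (integrable_tnth i mu2).
  have [int2 E2] := integral_image measurable_snd nuE (integrable_tnth i nu2).
  have -> : ((mean mu - mean nu) i ord0 =
     \int[g]_u (tnth u.1 i - tnth u.2 i))%R.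
    by rewrite !mxE /Rintegral E1 E2 -[LHS](RintegralB measurableT int1 int2).
  apply: sqr_Rintegral_le.
  by rewrite /comp; under eq_fun do rewrite EFinB; exact: integrableB.
rewrite lee_sqrt //; apply: le_trans inf_ge; rewrite lee_fin; exact: sqnorm_ge0.
Qed.

Lemma sqdist_tuple_map_le (R : realType) (n : nat) (f g : 'I_n -> R -> R)
    (x : n.-tuple R) (c : 'cV[R]_n) :
  (forall i, `|f i (tnth x i) - g i (tnth x i)| <= `|c i ord0|)%R ->
  (sqdist (tuple_map f x) (tuple_map g x) <= sqnorm c)%R.
Proof.
move=> h; apply: ler_sum => i _; rewrite !tnth_mktuple.
rewrite -(real_normK (num_real (c i ord0))) -(real_normK (num_real (_ - _)%R)).
by rewrite ler_sqr ?nnegrE.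
Qed.

Lemma latent_wasserstein2_le (R : realType) (n : nat) (y : n.-tuple bool)
    (v w : 'cV[R]_n) :
  wasserstein2 (latent y v) (latent y w) <= (Num.sqrt (sqnorm (v - w)))%:E.
Proof.
pose q (v : 'cV[R]_n) i := quantile (truncated_normal (v i ord0) (tnth y i)).
apply: (@wasserstein2_le _ _ _ _ (uniform_cube R n) (tuple_map (q v)) (tuple_map (q w))).
- by apply: measurable_tuple_map => i; exact: measurable_quantile.
- by apply: measurable_tuple_map => i; exact: measurable_quantile.
- by move=> A mA; exact: latent_quantile.
- by move=> A mA; exact: latent_quantile.
- exact: sqnorm_ge0.
move=> x; apply: sqdist_tuple_map_le => i; rewrite !mxE.
exact: truncated_normal_quantile_close.
Qed.

(** * Gaussian measures *)

Lemma measurable_gaussian_fun (R : realType) (n : nat) (m : 'cV[R]_n) (S : 'M[R]_n) :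
  measurable_fun setT (gaussian_fun m S).
Proof.
apply: measurableT_comp => //; apply: measurableT_comp => //.
apply: measurable_funM => //.
have -> : (fun x : n.-tuple R =>
      ((tvec x - m)^T *m invmx S *m (tvec x - m)) ord0 ord0) =
    (fun x => \sum_j (\sum_i (tnth x i - m i ord0) * invmx S i j) *
                      (tnth x j - m j ord0))%R.
  apply/funext => x; rewrite mxE; apply: eq_bigr => j _; rewrite !mxE; congr (_ * _)%R.
  by apply: eq_bigr => i _; rewrite !mxE.
have mc i : measurable_fun setT (fun x : n.-tuple R => tnth x i - m i ord0)%R.
  by apply: measurable_funB => //; exact: measurable_tnth.
apply: measurable_sum => j; apply: measurable_funM => //.
by apply: measurable_sum => i; apply: measurable_funM.
Qed.

(** Serves to bound |x|^2 + 1 by a product over the coordinates, whose integral factorises. *)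
Lemma sum_le_prod (R : realType) (I : finType) (a : I -> R) :
  (forall i, 0 <= a i)%R -> (\sum_i a i + 1 <= \prod_i (a i + 1))%R.
Proof.
move=> a0; elim: (index_enum I) => [|i r IH]; first by rewrite !big_nil add0r.
rewrite !big_cons mulrDl mul1r -addrA lerD // ler_peMr //.
apply: le_trans IH; rewrite lerDr sumr_ge0 //.
Qed.

Lemma prod_gaussE (R : realType) (n : nat) (c : R) (m : 'cV[R]_n) (x : n.-tuple R) :
  (\prod_i expR (- (c * (tnth x i - m i ord0) ^+ 2)) =
   expR (- (c * sqnorm (tvec x - m))))%R.
Proof.
rewrite -expR_sum /sqnorm mulr_sumr sumrN; congr (expR (- _))%R.
by apply: eq_bigr => i _; rewrite !mxE.
Qed.

Lemma gaussian_funE (R : realType) (n : nat) (m : 'cV[R]_n) (Q : 'M[R]_n) x :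
  (gaussian_fun m (invmx Q) x = expR (- (2^-1 * qform Q (tvec x - m))))%R.
Proof. by rewrite /gaussian_fun invmxK. Qed.

Lemma integral_gaussian_moment (R : realType) (n : nat) (m : 'cV[R]_n) (Q : 'M[R]_n) :
  posdefmx Q ->
  \int[@lebesgue_tuple R n]_x
    ((\sum_i tnth x i ^+ 2 + 1) * gaussian_fun m (invmx Q) x)%:E < +oo.
Proof.
move=> Qp; have [K K0 hK] := sqnorm_le_qform Qp.1 (posdefmx_ge0 Qp) (posdefmx_unit Qp).
(* Chosen so that a |v|^2 <= v^T Q v / 2, which dominates the density by a product of
   one-dimensional Gaussians; the summand 1 keeps the denominator positive. *)
pose a : R := (2 * (K + 1))^-1%R.
have K1 : (0 < K + 1)%R by rewrite ltr_wpDl.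
have a0 : (0 < a)%R by rewrite invr_gt0 mulr_gt0.
pose k i := (4 / a + 2 * m i ord0 ^+ 2 + 1)%R.
pose g i (x : R) := (k i * expR (- (a / 2 * (x - m i ord0) ^+ 2)))%R.
have k0 i : (0 <= k i)%R.
  by rewrite /k !addr_ge0 ?divr_ge0 ?(ltW a0) // mulr_ge0 // sqr_ge0.
have g0 i x : (0 <= g i x)%R by rewrite mulr_ge0 ?expR_ge0.
have mg i : measurable_fun setT (g i).
  by apply: measurable_funM => //; exact: measurable_gauss.
apply: (@le_lt_trans _ _ (\int[@lebesgue_tuple R n]_x (\prod_i g i (tnth x i))%:E)).
  apply: ge0_le_integral => //.
  - move=> x _; rewrite lee_fin mulr_ge0 ?expR_ge0 // addr_ge0 // sumr_ge0 // => i _.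
    exact: sqr_ge0.
  - apply/measurable_EFinP; apply: measurable_funM; last exact: measurable_gaussian_fun.
    by apply: measurable_funD => //; exact: measurable_sqsum.
  - apply/measurable_EFinP; apply: measurable_prod => i _.
    by apply: measurableT_comp => //; exact: measurable_tnth.
  - move=> x _; rewrite lee_fin.
    apply: (@le_trans _ _ (\prod_i (tnth x i ^+ 2 + 1) *
        \prod_i expR (- (a * (tnth x i - m i ord0) ^+ 2)))%R).
      apply: ler_pM; rewrite ?expR_ge0 ?addr_ge0 ?sumr_ge0 //.
      + by move=> i _; exact: sqr_ge0.
      + by apply: sum_le_prod => i; exact: sqr_ge0.
      rewrite prod_gaussE gaussian_funE ler_expR lerN2 /a invfM -mulrA ler_wpM2l ?invr_ge0 //.
      rewrite ler_pdivrMl //; apply: le_trans (hK _) _.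
      by rewrite mulrDl mul1r lerDl posdefmx_ge0.
    rewrite -big_split /=; apply: ler_prod => i _.
    by rewrite mulr_ge0 ?expR_ge0 ?addr_ge0 ?sqr_ge0 //= sqr_gauss_le.
rewrite (integral_prod_measure_prod _ mg g0) ltey_eq; apply/orP; left.
apply: (big_ind (fun x => x \is a fin_num)) => // [x z xf zf|i _]; first exact: fin_numM.
rewrite /g; under eq_integral do rewrite EFinM.
rewrite ge0_integralZl ?lee_fin //; last by apply/measurable_EFinP; exact: measurable_gauss.
by rewrite integral_gauss // divr_gt0.
Qed.

Lemma gaussian_weight_fin (R : realType) (n : nat) (m : 'cV[R]_n) (Q : 'M[R]_n) :
  posdefmx Q -> gaussian_weight m (invmx Q) setT \is a fin_num.
Proof.
move=> Qp; rewrite ge0_fin_numE //; apply: le_lt_trans (integral_gaussian_moment m Qp).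
apply: ge0_le_integral => //.
- by move=> x _; rewrite lee_fin expR_ge0.
- by apply/measurable_EFinP; exact: measurable_gaussian_fun.
- apply/measurable_EFinP; apply: measurable_funM; last exact: measurable_gaussian_fun.
  by apply: measurable_funD => //; exact: measurable_sqsum.
- move=> x _; rewrite lee_fin ler_peMl ?expR_ge0 // lerDr sumr_ge0 // => i _.
  exact: sqr_ge0.
Qed.

(** By v^T Q v <= L |v|^2, a product of one-dimensional Gaussians lies below the integrand. *)
Lemma gaussian_weight_gt0 (R : realType) (n : nat) (m : 'cV[R]_n) (Q : 'M[R]_n) :
  0 < gaussian_weight m (invmx Q) setT.
Proof.
have [L L0 hL] := qform_le_sqnorm Q.
pose b : R := (2^-1 * (L + 1))%R.
have b0 : (0 < b)%R by rewrite mulr_gt0 ?invr_gt0 // ltr_wpDl.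
pose g i (x : R) := expR (- (b * (x - m i ord0) ^+ 2))%R.
have g0 i x : (0 <= g i x)%R by exact: expR_ge0.
have mg i : measurable_fun setT (g i) by exact: measurable_gauss.
apply: (@lt_le_trans _ _ (\int[@lebesgue_tuple R n]_x (\prod_i g i (tnth x i))%:E)).
  rewrite (integral_prod_measure_prod _ mg g0).
  apply: (big_ind (fun x => 0 < x)) => // [x z x0 z0|i _]; first exact: mule_gt0.
  rewrite integral_gauss // lte_fin invr_gt0 normal_peak_gt0 // gt_eqF // sqrtr_gt0.
  by rewrite invr_gt0 mulr_gt0.
apply: ge0_le_integral => //.
- by move=> x _; rewrite lee_fin prodr_ge0.
- apply/measurable_EFinP; apply: measurable_prod => i _.
  by apply: measurableT_comp => //; exact: measurable_tnth.
- by apply/measurable_EFinP; exact: measurable_gaussian_fun.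
- move=> x _; rewrite lee_fin prod_gaussE gaussian_funE ler_expR lerN2 -mulrA.
  rewrite ler_wpM2l ?invr_ge0 //; apply: le_trans (hL _) _.
  by rewrite mulrDl mul1r lerDl sqnorm_ge0.
Qed.

Lemma gaussianE (R : realType) (n : nat) (m : 'cV[R]_n) (Q : 'M[R]_n)
    (A : set (n.-tuple R)) : posdefmx Q ->
  gaussian m (invmx Q) A =
  (fine (gaussian_weight m (invmx Q) setT))^-1%:E * gaussian_weight m (invmx Q) A.
Proof.
move=> Qp; exact: (mnormalizeE _ _ (gaussian_weight_gt0 m Q) (gaussian_weight_fin m Qp)).
Qed.

Lemma gaussian_finite_second_moment (R : realType) (n : nat) (m : 'cV[R]_n)
    (Q : 'M[R]_n) : posdefmx Q -> finite_second_moment (gaussian m (invmx Q)).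
Proof.
move=> Qp; rewrite /finite_second_moment integral_mnormalize; first last.
- by move=> x; rewrite lee_fin sumr_ge0 // => i _; exact: sqr_ge0.
- by apply/measurable_EFinP; exact: measurable_sqsum.
- exact: gaussian_weight_fin.
- exact: gaussian_weight_gt0.
rewrite lte_mul_pinfty // ?lee_fin ?invr_ge0 ?fine_ge0 //.
have := @integral_density_le R _ _ (@lebesgue_tuple R n)
  (gaussian_weight m (invmx Q)) _ _ (measurable_gaussian_fun m _) (@measurable_sqsum R n)
  (fun x => expR_ge0 _) _ (fun A _ => erefl _).
move=> /(_ (fun x => sumr_ge0 _ (fun i _ => sqr_ge0 _))) /le_lt_trans; apply.
exact: integral_gaussian_moment.
Qed.

Definition translate (R : realType) (n : nat) (d : 'cV[R]_n) : n.-tuple R -> n.-tuple R :=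
  tuple_map (fun i x => x + d i ord0)%R.

Lemma measurable_translate (R : realType) (n : nat) (d : 'cV[R]_n) :
  measurable_fun setT (translate d).
Proof.
by apply: measurable_tuple_map => i; apply: measurable_funD => //; exact: measurable_id.
Qed.

Lemma lebesgue_tuple_translate (R : realType) (n : nat) (d : 'cV[R]_n)
    (A : set (n.-tuple R)) : measurable A ->
  lebesgue_tuple R n A = lebesgue_tuple R n (translate d @^-1` A).
Proof.
move=> mA; apply: prod_measure_map => //.
- by move=> i; apply: measurable_funD => //; exact: measurable_id.
- by move=> i B mB; exact: lebesgue_measure_translate.
Qed.

(** Translation by m' - m preserves Lebesgue measure and carries the exponent centred at m' to the
    one centred at m. The same identity on the whole space equates the normalising constants. *)
Lemma gaussian_translate (R : realType) (n : nat) (m m' : 'cV[R]_n) (Q : 'M[R]_n)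
    (A : set (n.-tuple R)) : posdefmx Q -> measurable A ->
  gaussian m' (invmx Q) A = gaussian m (invmx Q) (translate (m' - m) @^-1` A).
Proof.
move=> Qp mA; set d := (m' - m)%R; rewrite [LHS](gaussianE _ _ Qp) [RHS](gaussianE _ _ Qp).
have wE B : measurable B -> gaussian_weight m' (invmx Q) B =
    gaussian_weight m (invmx Q) (translate d @^-1` B).
  move=> mB; have mG : measurable_fun B (EFin \o gaussian_fun m' (invmx Q)).
    by apply: measurable_funTS; apply/measurable_EFinP; exact: measurable_gaussian_fun.
  have G0 x : 0 <= (EFin \o gaussian_fun m' (invmx Q)) x.
    by rewrite lee_fin expR_ge0.
  apply: (etrans (ge0_integral_image (measurable_translate d)
    (@lebesgue_tuple_translate R n d) mB mG G0)).
  apply: eq_integral => x _; rewrite /= !gaussian_funE.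
  suff -> : (tvec (translate d x) - m' = tvec x - m)%R by [].
  by apply/matrixP => i j; rewrite !mxE tnth_mktuple (ord1 j) !mxE addrA addrAC addrK.
exact: (congr2 (fun a b => (fine a)^-1%:E * b) (wE setT measurableT) (wE A mA)).
Qed.

Lemma gaussian_wasserstein2_le (R : realType) (n : nat) (m m' : 'cV[R]_n) (Q : 'M[R]_n) :
  posdefmx Q ->
  wasserstein2 (gaussian m (invmx Q)) (gaussian m' (invmx Q)) <=
  (Num.sqrt (sqnorm (m - m')))%:E.
Proof.
move=> Qp; apply: (@wasserstein2_le _ _ _ _ (gaussian m (invmx Q)) id (translate (m' - m))).
- exact: measurable_id.
- exact: measurable_translate.
- by [].
- by move=> A mA; exact: gaussian_translate.
- exact: sqnorm_ge0.
move=> x; apply: ler_sum => i _; rewrite tnth_mktuple !mxE.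
by rewrite opprD addNKr opprB.
Qed.

Lemma mean_translate (R : realType) (n : nat) (mu nu : probability (n.-tuple R) R)
    (d : 'cV[R]_n) :
  finite_second_moment mu -> finite_second_moment nu ->
  (forall A, measurable A -> nu A = mu (translate d @^-1` A)) ->
  (mean nu = mean mu + d)%R.
Proof.
move=> mu2 nu2 E; apply/matrixP => i j; rewrite (ord1 j) !mxE.
have [_ h] := integral_image (measurable_translate d) E (integrable_tnth i nu2).
rewrite {1}/Rintegral h -/(Rintegral mu setT (fun x => tnth (translate d x) i)).
under eq_Rintegral do rewrite tnth_mktuple.
rewrite RintegralD //; first last.
- exact: finite_measure_integrable_cst.
- exact: integrable_tnth.
by rewrite Rintegral_cst //= probability_setT /= mulr1.
Qed.

Lemma mean_gaussianB (R : realType) (n : nat) (m m' : 'cV[R]_n) (Q : 'M[R]_n) :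
  posdefmx Q ->
  (mean (gaussian m (invmx Q)) - mean (gaussian m' (invmx Q)) = m - m')%R.
Proof.
move=> Qp; apply/eqP; rewrite subr_eq addrC; apply/eqP.
apply: mean_translate; [exact: gaussian_finite_second_moment..|].
by move=> A mA; exact: gaussian_translate.
Qed.

(** * Convergence of the means and of the iterates *)

Local Close Scope ereal_scope.

(** By the parallelogram identity, the two sides differ by the form at u - v. *)
Lemma qformD_le (R : realType) (p : nat) (Q : 'M[R]_p) u v : posdefmx Q ->
  qform Q (u + v) <= 2 * (qform Q u + qform Q v).
Proof.
move=> Qp; have := posdefmx_ge0 Qp (u + (-1) *: v).
rewrite !bformDl !bformDr !bformZl !bformZr; lra.
Qed.

(** The sequence is its initial value plus the series of its increments, which a geometric series
    dominates. *)
Lemma cauchy_geometric_cvg (R : realType) (u : R ^nat) (B r : R) : 0 <= r < 1 ->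
  (forall k, `|u k.+1 - u k| <= B * r ^+ k) -> cvgn u.
Proof.
move=> /andP[r0 r1] hu; have cvg_tel : cvgn (series (telescope u)).
  apply: normed_cvg; apply: (@series_le_cvg _ _ (geometric B r)) => //.
  - by move=> k; rewrite /= normr_ge0.
  - by move=> k; rewrite /= (le_trans _ (hu k)).
  - by apply: is_cvg_geometric_series; rewrite ger0_norm.
have -> : u = fun k => series (telescope u) k + u 0%N.
  by apply/funext => k; rewrite telescopeK subrK.
by apply: is_cvgD => //; exact: is_cvg_cst.
Qed.

(* The iterates are Cauchy coordinatewise, since Q dominates the Euclidean norm. *)
Lemma qform_contraction_fixpoint (R : realType) (p : nat) (Q : 'M[R]_p)
    (T : 'cV[R]_p -> 'cV[R]_p) (r : R) : posdefmx Q -> 0 <= r < 1 ->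
  (forall a b, qform Q (T a - T b) <= r ^+ 2 * qform Q (a - b)) ->
  exists l, T l = l.
Proof.
move=> Qp r01 hT; have /andP[r0 r1] := r01.
have [K K0 hK] := sqnorm_le_qform Qp.1 (posdefmx_ge0 Qp) (posdefmx_unit Qp).
have [L L0 hL] := qform_le_sqnorm Q.
pose x k := iter k T 0; pose D := qform Q (x 1%N - x 0%N).
have D0 : 0 <= D by exact: posdefmx_ge0.
have hx k : qform Q (x k.+1 - x k) <= (r ^+ k) ^+ 2 * D.
  elim: k => [|k IH]; first by rewrite expr0 expr1n mul1r.
  apply: le_trans (hT _ _) _.
  have -> : (r ^+ k.+1) ^+ 2 * D = r ^+ 2 * ((r ^+ k) ^+ 2 * D) by rewrite (exprS r k); ring.
  exact: ler_wpM2l (sqr_ge0 r) _ _ IH.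
have cvgx i : cvgn (fun k => x k i ord0).
  apply: (@cauchy_geometric_cvg _ _ (Num.sqrt (K * D)) r) => // k.
  rewrite -ler_sqr ?nnegrE ?mulr_ge0 ?exprn_ge0 // real_normK ?num_real //.
  rewrite exprMn sqr_sqrtr ?mulr_ge0 // mulrAC -mulrA.
  apply: le_trans (le_trans (hK (x k.+1 - x k)) _); last by rewrite ler_wpM2l.
  rewrite /sqnorm (bigD1 i) //= !mxE lerDl sumr_ge0 // => j _; exact: sqr_ge0.
pose l : 'cV[R]_p := \col_i limn (fun k => x k i ord0).
have cvg0 : sqnorm (x k - l) @[k --> \oo] --> (0 : R).
  rewrite /sqnorm; elim: (index_enum _) => [|i s IH].
    by under eq_fun do rewrite big_nil; exact: cvg_cst.
  under eq_fun do rewrite big_cons.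
  have h : x k i ord0 - l i ord0 @[k --> \oo] --> (0 : R).
    have li : x k i ord0 @[k --> \oo] --> l i ord0 by rewrite mxE; exact: cvgx.
    by have := cvgB li (cvg_cst (l i ord0)); rewrite subrr; apply.
  have h2 : (x k - l) i ord0 ^+ 2 @[k --> \oo] --> (0 : R).
    have -> : (fun k => (x k - l) i ord0 ^+ 2) =
        (fun k => (x k i ord0 - l i ord0) * (x k i ord0 - l i ord0)).
      by apply/funext => k; rewrite !mxE expr2.
    by have := cvgM h h; rewrite mul0r; apply.
  by have := cvgD h2 IH; rewrite addr0; apply.
(* If T l - l were nonzero its form would be positive, but that form is below every term of a
   sequence tending to 0. *)
exists l; apply/eqP; rewrite -subr_eq0; apply/negPn/negP => /Qp.2.
rewrite ltNge => /negP; apply.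
have cvg2 : 2 * L * (sqnorm (x k - l) + sqnorm (x k.+1 - l)) @[k --> \oo] --> (0 : R).
  have cvgS : sqnorm (x k.+1 - l) @[k --> \oo] --> (0 : R).
    by have := cvg0; rewrite -(cvg_shiftS (fun k => sqnorm (x k - l))).
  have := @cvgMl_tmp _ _ _ _ _ (2 * L) _ (cvgD cvg0 cvgS); rewrite addr0 mulr0; apply.
apply: (cvgr_to_ge cvg2); apply: nearW => k.
(* Splitting at T (x k) = x (k + 1) leaves one term controlled by the contraction and one by
   convergence. *)
have -> : T l - l = (T l - T (x k)) + (x k.+1 - l) by rewrite addrA subrK.
apply: le_trans (qformD_le _ _ Qp) _; rewrite -mulrA ler_wpM2l // mulrDr lerD //.
apply: le_trans (hT _ _) (le_trans _ (hL _)).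
have -> : qform Q (x k - l) = qform Q (l - x k).
  by rewrite -opprB -scaleN1r bformZl bformZr mulN1r mulN1r opprK.
by apply: ler_piMl; rewrite ?posdefmx_ge0 // exprn_ile1 // ltW.
Qed.

Section cavi_map.
Variables (R : realType) (n p : nat) (X : 'M[R]_(n, p)) (y : n.-tuple bool).
Variables (m0 : 'cV[R]_p) (Q0 : 'M[R]_p) (Q0_posdef : posdefmx Q0).

Let Q := Q0 + X^T *m X.

Let Q_posdef : posdefmx Q. Proof. exact: posdefmxD_gram. Qed.

Lemma mean_update2B mu1 nu1 :
  mean (update2 X m0 Q0 mu1) - mean (update2 X m0 Q0 nu1) =
  invmx Q *m (X^T *m (mean mu1 - mean nu1)).
Proof.
rewrite /update2 [LHS](mean_gaussianB _ _ Q_posdef) -mulmxBr; congr (_ *m _).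
by rewrite opprD addrACA subrr add0r mulmxBr.
Qed.

Lemma update2_wasserstein2_le mu1 nu1 :
  (wasserstein2 (update2 X m0 Q0 mu1) (update2 X m0 Q0 nu1) <=
   (Num.sqrt (sqnorm (mean (update2 X m0 Q0 mu1) - mean (update2 X m0 Q0 nu1))))%:E)%E.
Proof.
rewrite {2 3}/update2 (mean_gaussianB _ _ Q_posdef).
exact: gaussian_wasserstein2_le.
Qed.

Lemma update2_finite_second_moment mu1 : finite_second_moment (update2 X m0 Q0 mu1).
Proof. exact: gaussian_finite_second_moment. Qed.

(** One full sweep of the algorithm, seen on the mean of the beta-block, which is all that the sweep
    reads from the current state. *)
Definition mean_map (a : 'cV[R]_p) : 'cV[R]_p :=
  mean (update2 X m0 Q0 (latent y (X *m a))).

Lemma mean_latent_lipschitz (v w : 'cV[R]_n) :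
  sqnorm (mean (latent y v) - mean (latent y w)) <= sqnorm (v - w).
Proof.
have := le_trans (wasserstein2_ge (latent_finite_second_moment y v)
  (latent_finite_second_moment y w)) (latent_wasserstein2_le y v w).
by rewrite lee_fin ler_sqrt ?sqnorm_ge0.
Qed.

Lemma mean_map_contraction (r : R) : 0 <= r ->
  (forall v, sqnorm (X *m v) <= r * qform Q v) ->
  forall a b, qform Q (mean_map a - mean_map b) <= r ^+ 2 * qform Q (a - b).
Proof.
move=> r0 hr a b; rewrite mean_update2B.
set g := _ - _; set u := invmx Q *m _.
have hg : sqnorm g <= r * qform Q (a - b).
  by apply: le_trans (mean_latent_lipschitz _ _) _; rewrite -mulmxBr.
(* Since Q u = X^T g, the form at u is the Euclidean product of X u and g. *)
have quE : qform Q u = bform 1%:M (X *m u) g.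
  rewrite /bform -mulmxA mulKVmx ?posdefmx_unit // mulmxA mulmx1.
  by rewrite (trmx_mul X u).
have q1 (v : 'cV[R]_n) : qform 1%:M v = sqnorm v.
  by rewrite /bform mulmx1 mxE; apply: eq_bigr => i _; rewrite mxE expr2.
have cs : qform Q u ^+ 2 <= sqnorm (X *m u) * sqnorm g.
  rewrite quE -!q1; apply: bform_CauchySchwarz; first exact: trmx1.
  by move=> w; rewrite q1 sqnorm_ge0.
have q0 v : 0 <= qform Q v by exact: posdefmx_ge0.
(* One factor r comes from |X u|^2 <= r u^T Q u, the other from the Lipschitz bound [hg]; cancelling
   [qform Q u] leaves r^2. *)
have {cs} : qform Q u ^+ 2 <= (r * qform Q u) * (r * qform Q (a - b)).
  by apply: le_trans cs _; rewrite ler_pM ?sqnorm_ge0.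
have [->|qu] := eqVneq (qform Q u) 0; first by rewrite mulr_ge0 ?sqr_ge0.
have qu0 : 0 < qform Q u by rewrite lt_def qu q0.
set q := qform Q u in qu0 *; set q' := qform Q (a - b).
have -> : r * q * (r * q') = q * (r ^+ 2 * q') by ring.
by rewrite expr2 ler_pM2l.
Qed.

End cavi_map.

Lemma wasserstein2_ge0 (R : realType) (n : nat) (mu nu : probability (n.-tuple R) R) :
  (0 <= wasserstein2 mu nu)%E.
Proof. exact: poweR_ge0. Qed.

Lemma sqrt_le_mul (R : realType) (x c d : R) : 0 <= c -> 0 <= d ->
  x <= c ^+ 2 * d -> Num.sqrt x <= c * Num.sqrt d.
Proof.
move=> c0 d0 xcd; have -> : c * Num.sqrt d = Num.sqrt (c ^+ 2 * d).
  by rewrite sqrtrM ?sqr_ge0 // sqrtr_sqr ger0_norm.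
by rewrite ler_wsqrtr.
Qed.

Theorem proposition13 (R : realType) (n p : nat) (p_gt0 : (0 < p)%N)
    (X : 'M[R]_(n, p)) (y : n.-tuple bool) (m0 : 'cV[R]_p) (Q0 : 'M[R]_p)
    (Q0_posdef : posdefmx Q0) :
  let r := lambda_max (invmx (Q0 + X^T *m X) *m (X^T *m X)) in
  0 <= r < 1 /\
  exists (mu1s : probability (n.-tuple R) R) (mu2s : probability (p.-tuple R) R),
    [/\ finite_second_moment mu1s /\ finite_second_moment mu2s,
        cavi_fixed_point X y m0 Q0 (mu1s, mu2s),
        (forall (nu1 : probability (n.-tuple R) R)
                (nu2 : probability (p.-tuple R) R),
           finite_second_moment nu1 -> finite_second_moment nu2 ->
           cavi_fixed_point X y m0 Q0 (nu1, nu2) -> nu1 = mu1s /\ nu2 = mu2s)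
      & exists C : R, 0 <= C /\
        forall (mu10 : probability (n.-tuple R) R)
               (mu20 : probability (p.-tuple R) R),
          finite_second_moment mu10 -> finite_second_moment mu20 ->
          forall k : nat,
            let mu := cavi X y m0 Q0 (mu10, mu20) k in
            (wasserstein2 mu.1 mu1s + wasserstein2 mu.2 mu2s <=
             (C * r ^+ k)%:E *
             (wasserstein2 mu10 mu1s + wasserstein2 mu20 mu2s))%E].
Proof.
have [] := lambda_maxP X p_gt0 Q0_posdef.
set r := lambda_max _; set Q := Q0 + X^T *m X => r01 hX.
have [r0 r1] := andP r01; split=> //.
have Qp : posdefmx Q by exact: posdefmxD_gram.
have Q_ge0 := posdefmx_ge0 Qp.
have [K K0 hK] := sqnorm_le_qform Qp.1 Q_ge0 (posdefmx_unit Qp).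
have [L L0 hL] := qform_le_sqnorm Q.
pose T := mean_map X y m0 Q0.
have hT a b : qform Q (T a - T b) <= r ^+ 2 * qform Q (a - b).
  exact: mean_map_contraction.
have [l Tl] := qform_contraction_fixpoint Qp r01 hT.
(* The fixed point is rebuilt from its beta-mean l; that [mu2s] has mean l is exactly [T l = l]. *)
pose mu1s := latent y (X *m l); pose mu2s := update2 X m0 Q0 mu1s.
have mean2 : mean mu2s = l by [].
have mu1s2 : finite_second_moment mu1s by exact: latent_finite_second_moment.
have mu2s2 : finite_second_moment mu2s by exact: update2_finite_second_moment.
have update1E (mu : probability (p.-tuple R) R) :
  update1 X y mu = latent y (X *m mean mu) by [].
exists mu1s, mu2s; split; first exact: conj.
- by split; rewrite /= ?update1E ?mean2.
- move=> nu1 nu2 _ _ [nu1E' nu2E'].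
  have nu1E : nu1 = latent y (X *m mean nu2) := nu1E'.
  have nu2E : nu2 = update2 X m0 Q0 nu1 := nu2E'.
  (* A fixed point is determined by its beta-mean, which is fixed by T; uniqueness follows from r^2
     < 1. *)
  suff nu2l : mean nu2 = l.
    have nu1s : nu1 = mu1s by rewrite nu1E nu2l.
    exact (conj nu1s (etrans nu2E (congr1 (update2 X m0 Q0) nu1s))).
  have Tnu2 : T (mean nu2) = mean nu2.
    exact: esym (etrans (congr1 (@mean R p) nu2E)
      (congr1 (fun nu => mean (update2 X m0 Q0 nu)) nu1E)).
  apply/eqP; rewrite -subr_eq0; apply/negPn/negP => /Qp.2.
  have := hT (mean nu2) l; rewrite Tnu2 Tl -/(qform Q (mean nu2 - l)).
  set q := qform Q _ => qle q_gt0.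
  have : r ^+ 2 * q < q by rewrite gtr_pMl // exprn_ilt1.
  by rewrite ltNge qle.
(* The z-block at step k + 1 is computed from the beta-mean at step k; the factor 1 + r^-1 pays for
   the missing power of r. [C2] is the price of passing between the Euclidean norm and that of Q. *)
pose C1 := Num.sqrt L * (1 + r^-1); pose C2 := Num.sqrt (K * L).
have C10 : 0 <= C1 by rewrite mulr_ge0 // addr_ge0 // invr_ge0.
have C20 : 0 <= C2 by exact: sqrtr_ge0.
exists (1 + C1 + C2); split; first by rewrite !addr_ge0.
move=> mu10 mu20 mu102 mu202 k; lazy zeta.
have W10 := wasserstein2_ge0 mu10 mu1s; have W20 := wasserstein2_ge0 mu20 mu2s.
(* At k = 0 the blocks are arbitrary initial measures, and the summand 1 of the constant gives the
   bound. *)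
case: k => [|k].
  rewrite expr0 mulr1 -[leLHS]mul1e lee_wpmul2r ?adde_ge0 // lee_fin.
  by rewrite -addrA lerDl addr_ge0.
pose mu := cavi X y m0 Q0 (mu10, mu20) k.+1; rewrite -/mu.
pose a j := mean (cavi X y m0 Q0 (mu10, mu20) j).2.
have aS j : a j.+1 = T (a j) by [].
pose d := sqnorm (a 0%N - l); have d0 : 0 <= d by exact: sqnorm_ge0.
have ha j : qform Q (a j - l) <= (r ^+ j) ^+ 2 * (L * d).
  elim: j => [|j IH]; first by rewrite expr0 expr1n mul1r hL.
  rewrite aS -[X in T _ - X]Tl; apply: le_trans (hT _ _) _.
  have -> : (r ^+ j.+1) ^+ 2 * (L * d) = r ^+ 2 * ((r ^+ j) ^+ 2 * (L * d)).
    by rewrite (exprS r j); ring.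
  exact: ler_wpM2l (sqr_ge0 r) _ _ IH.
have h1 : (wasserstein2 mu.1 mu1s <= (C1 * r ^+ k.+1 * Num.sqrt d)%:E)%E.
  apply: le_trans (latent_wasserstein2_le _ _ _) _; rewrite lee_fin -mulmxBr.
  apply: sqrt_le_mul => //; first by rewrite mulr_ge0 ?exprn_ge0.
  apply: le_trans (hX _) _; apply: le_trans (ler_wpM2l r0 (ha k)) _.
  have -> : (C1 * r ^+ k.+1) ^+ 2 * d =
      ((1 + r^-1) ^+ 2 * r ^+ 2) * ((r ^+ k) ^+ 2 * (L * d)).
    rewrite /C1 (exprS r k); set t := 1 + _; set u := r ^+ k.
    have := sqr_sqrtr L0; set q := Num.sqrt L => <-; ring.
  apply: ler_wpM2r; first by rewrite mulr_ge0 ?sqr_ge0 // mulr_ge0.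
  (* For r = 0 both sides vanish, with r^-1 read as 0; otherwise the claim is r <= (r + 1)^2. *)
  have [->|rN] := eqVneq r 0; first by rewrite expr0n /= mulr0.
  have -> : (1 + r^-1) ^+ 2 * r ^+ 2 = (r + 1) ^+ 2 by field.
  by rewrite sqrrD1; have := sqr_ge0 r; lra.
have h2 : (wasserstein2 mu.2 mu2s <= (C2 * r ^+ k.+1 * Num.sqrt d)%:E)%E.
  have hM : (wasserstein2 mu.2 mu2s <= (Num.sqrt (sqnorm (a k.+1 - l)))%:E)%E.
    rewrite -mean2; exact: update2_wasserstein2_le.
  apply: le_trans hM _; rewrite lee_fin; apply: sqrt_le_mul => //.
    by rewrite mulr_ge0 ?exprn_ge0.
  apply: le_trans (hK _) _; apply: le_trans (ler_wpM2l K0 (ha k.+1)) _.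
  rewrite exprMn /C2 sqr_sqrtr ?mulr_ge0 // le_eqVlt; apply/orP; left.
  by apply/eqP; ring.
(* The bounds so far involve only the initial beta-means, whose distance is at most the W2 distance
   of the beta-blocks. *)
have hd : ((Num.sqrt d)%:E <= wasserstein2 mu10 mu1s + wasserstein2 mu20 mu2s)%E.
  have := wasserstein2_ge mu202 mu2s2; rewrite mean2 => h.
  exact: le_trans h (leeDr _ W10).
apply: le_trans (leeD h1 h2) _; rewrite -EFinD -!mulrDl.
apply: (@le_trans _ _ (((1 + C1 + C2) * r ^+ k.+1)%:E * (Num.sqrt d)%:E)%E).
  by rewrite -EFinM lee_fin ler_wpM2r // ler_wpM2r ?exprn_ge0 // lerD2r lerDr.
by apply: lee_wpmul2l => //; rewrite lee_fin mulr_ge0 ?exprn_ge0 // !addr_ge0.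
Qed.
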